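(* Let $\alpha,\beta\in\mathbb{C}$. Let $n<\infty$, let $w_1,w_2\in\mathbb{F}_n$ be distinct reduced words, and let $\ell$ be the length of the reduced word $w_2^{-1}w_1$. Then there exists a representation $\pi:C^*(\mathbb{F}_n)\to\mathbb{M}_{2\ell}$ such that $$\|\pi(\alpha w_1+\beta w_2)\|=|\alpha|+|\beta|.$$
   Context: $\mathbb{F}_n$ is the free group on $n$ generators, $C^*(\mathbb{F}_n)$ its full group $C^*$-algebra (with elements of $\mathbb{F}_n$ viewed as unitaries in it), and $\mathbb{M}_d$ the $C^*$-algebra of complex $d\times d$ matrices with operator norm. A representation $C^*(\mathbb{F}_n)\to\mathbb{M}_d$ is a $*$-homomorphism. The reduced word $w_2^{-1}w_1$ means the reduced form of that product, and its length is its word length in the generators and their inverses. *)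

(* Defs.v *)
From HB Require Import structures.
From mathcomp Require Import all_boot all_order all_algebra.
From mathcomp Require Import finmap complex.
From mathcomp Require Import ring.
From mathcomp Require Import all_classical all_reals all_analysis.

Set Implicit Arguments.
Unset Strict Implicit.
Unset Printing Implicit Defensive.

Import Order.TTheory GRing.Theory Num.Theory.
Import numFieldNormedType.Exports.
Import ComplexField.Normc.

Local Open Scope classical_set_scope.
Local Open Scope ring_scope.
Local Open Scope complex_scope.

(* The letter (i, true) is the i-th generator and (i, false) its inverse. *)
Definition letter (n : nat) : Type := ('I_n * bool)%type.

HB.instance Definition _ n := Finite.on (letter n).

Section FreeGroup.
Variable n : nat.
Implicit Types (x y : letter n) (s t u : seq (letter n)).

Definition linv x : letter n := (x.1, ~~ x.2).

Definition reduced s : bool := sorted (fun x y => y != linv x) s.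

Definition push x s : seq (letter n) :=
  if s is y :: s' then if y == linv x then s' else x :: s else [:: x].

Lemma linvK : involutive linv.
Proof. by move=> [i b]; rewrite /linv /= negbK. Qed.

Lemma reduced_push x s : reduced s -> reduced (push x s).
Proof.
case: s => //= y s redys; case: eqP => [_|/eqP yx]; last by rewrite /= yx.
by case: s redys => //= z s /andP[].
Qed.

Lemma reduced_foldr s t : reduced t -> reduced (foldr push t s).
Proof. by move=> redt; elim: s => //= x s; apply: reduced_push. Qed.

Lemma pushK x s : reduced s -> push x (push (linv x) s) = s.
Proof.
case: s => [|y s] /=; first by rewrite eqxx.
rewrite linvK; case: eqP => [->|_] /=; last by rewrite eqxx.
case: s => //= z s /andP[/negPf]; by case: ifP => // ->.
Qed.

Lemma foldr_push x s u : reduced u ->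
  foldr push u (push x s) = push x (foldr push u s).
Proof.
move=> redu; case: s => //= y s; case: eqP => // ->.
by rewrite pushK // reduced_foldr.
Qed.

Lemma foldr_pushA s t u : reduced u ->
  foldr push (foldr push u t) s = foldr push u (foldr push t s).
Proof. by move=> redu; elim: s => //= x s ->; rewrite foldr_push. Qed.

Lemma foldr_push0 s : reduced s -> foldr push [::] s = s.
Proof.
elim: s => //= x s IHs redxs.
rewrite IHs; last by case: s redxs {IHs} => //= y s /andP[].
by case: s redxs {IHs} => //= y s /andP[/negPf ->].
Qed.

Lemma reduced_inv s : reduced s -> reduced (rev (map linv s)).
Proof.
rewrite /reduced rev_sorted sorted_map; apply: sub_sorted => x y /=.
by apply: contraNN => /eqP xy; rewrite -(linvK y) -xy.
Qed.

Lemma foldr_push_inv s : foldr push s (rev (map linv s)) = [::].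
Proof.
elim: s => //= x s IHs; rewrite rev_cons foldr_rcons /= linvK eqxx; exact: IHs.
Qed.

Record freegroup := FreeGroup {
  fgword :> seq (letter n);
  fgwordP : reduced fgword }.

HB.instance Definition _ := [isSub for fgword].
HB.instance Definition _ := [Choice of freegroup by <:].

Definition fgone : freegroup := @FreeGroup [::] isT.

Definition fgmul (a b : freegroup) : freegroup :=
  FreeGroup (reduced_foldr a (fgwordP b)).

Definition fginv (a : freegroup) : freegroup :=
  FreeGroup (reduced_inv (fgwordP a)).

Lemma fgmulA : associative fgmul.
Proof. by move=> a b c; apply/val_inj/foldr_pushA/fgwordP. Qed.

Lemma fgmul1 : left_id fgone fgmul.
Proof. by move=> a; apply: val_inj. Qed.

Lemma fgmulr1 : right_id fgone fgmul.
Proof. by move=> a; apply/val_inj/foldr_push0/fgwordP. Qed.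

Lemma fgmulV : left_inverse fgone fginv fgmul.
Proof. by move=> a; apply/val_inj/foldr_push_inv. Qed.

Lemma fgmulrV : right_inverse fgone fginv fgmul.
Proof.
move=> a; apply/val_inj => /=.
have := foldr_push_inv (rev (map linv a)).
by rewrite map_rev revK mapK //; apply: linvK.
Qed.

HB.instance Definition _ := isGroup.Build freegroup
  fgmulA fgmul1 fgmulr1 fgmulV fgmulrV.

End FreeGroup.

Definition wlen n (w : freegroup n) : nat := size (fgword w).

HB.mixin Record isStarAlgebra (R : rcfType) A of GRing.Algebra R[i] A := {
  star : A -> A;
  starK : involutive star;
  starD : {morph star : x y / x + y};
  starZ : forall (c : R[i]) (x : A), star (c *: x) = c^* *: star x;
  starM : forall x y, star (x * y) = star y * star x
}.

#[short(type="starAlgType")]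
HB.structure Definition StarAlgebra (R : rcfType) :=
  { A of isStarAlgebra R A & GRing.Algebra R[i] A }.

Section GroupAlgebra.
Variables (R : rcfType) (G : groupType).
Local Notation C := R[i].

Definition finsupp_pred : {pred G -> C} :=
  fun f => `[< finite_set [set g | f g != 0] >].

Record grpalg := GrpAlg { gcoef :> G -> C; gcoefP : finsupp_pred gcoef }.

HB.instance Definition _ := [isSub for gcoef].
HB.instance Definition _ := [Choice of grpalg by <:].

Let finsupp_submod : GRing.submod_closed finsupp_pred.
Proof.
split=> [|c f g /asboolP f_fin /asboolP g_fin]; apply/asboolP.
  by apply: (sub_finite_set _ (finite_set0 G)) => g /eqP; case.
apply: (sub_finite_set _ _ (B := [set g | f g != 0] `|` [set x | g x != 0])).
  move=> x /=; rewrite !fctE; case: (eqVneq (f x) 0) => [->|]; last by left.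
  by rewrite scaler0 add0r; right.
by rewrite finite_setU.
Qed.

HB.instance Definition _ :=
  GRing.SubChoice_isSubLmodule.Build _ _ _ grpalg finsupp_submod.

Implicit Types (a b f : grpalg) (g h : G) (c : C).

Lemma gcoefD a b g : (a + b) g = a g + b g. Proof. by []. Qed.
Lemma gcoefZ c a g : (c *: a) g = c * a g. Proof. by []. Qed.
Lemma gcoef0 g : (0 : grpalg) g = 0. Proof. by []. Qed.

Lemma gcoef_inj a b : a =1 b -> a = b.
Proof. by move=> ab; apply/val_inj/funext. Qed.

Definition gsupp f : {fset G} := fset_set [set g | f g != 0].

Lemma mem_gsupp f g : (g \in gsupp f) = (f g != 0).
Proof. by rewrite in_fset_set ?in_setE //; [apply/idP/idP; rewrite inE|exact/asboolP/gcoefP]. Qed.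

Fact gelt_subproof g : finsupp_pred (fun h => (h == g)%:R).
Proof.
apply/asboolP; apply: (sub_finite_set _ (finite_set1 g)) => h /=.
by have [//|_] := eqVneq h g; rewrite eqxx.
Qed.

Definition gelt g : grpalg := GrpAlg (gelt_subproof g).

Lemma gelt_coef g h : gelt g h = (h == g)%:R. Proof. by []. Qed.

(* Linear extension to C[G] of a map defined on G. *)
Definition glift (V : lmodType C) (F : G -> V) f : V :=
  \sum_(g <- gsupp f) f g *: F g.

Section Glift.
Variables (V : lmodType C) (F : G -> V).

Lemma gliftEw (s : {fset G}) f : (gsupp f `<=` s)%fset ->
  glift F f = \sum_(g <- s) f g *: F g.
Proof.
move=> fs; apply: big_fset_incl => // g _.
by rewrite mem_gsupp negbK => /eqP ->; rewrite scale0r.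
Qed.

Lemma glift_is_linear : linear (glift F).
Proof.
move=> c a b; pose s := (gsupp a `|` gsupp b `|` gsupp (c *: a + b)%R)%fset.
have sa : (gsupp a `<=` s)%fset by rewrite /s -fsetUA fsubsetUl.
have sb : (gsupp b `<=` s)%fset by rewrite /s (fsetUC (gsupp a)) -fsetUA fsubsetUl.
have sab : (gsupp (c *: a + b)%R `<=` s)%fset by rewrite /s fsubsetUr.
rewrite (gliftEw sa) (gliftEw sb) (gliftEw sab).
rewrite scaler_sumr -big_split; apply: eq_bigr => g _.
by rewrite gcoefD gcoefZ scalerDl scalerA.
Qed.

HB.instance Definition _ :=
  GRing.isLinear.Build C grpalg V *:%R (glift F) glift_is_linear.

Lemma glift_gelt g : glift F (gelt g) = F g.
Proof.
rewrite (@gliftEw [fset g]%fset).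
  by rewrite big_seq_fset1 gelt_coef eqxx scale1r.
by apply/fsubsetP => h; rewrite mem_gsupp gelt_coef inE; have [//|_] := eqVneq h g; rewrite eqxx.
Qed.

End Glift.

Lemma grpalgE f : f = \sum_(g <- gsupp f) f g *: gelt g.
Proof.
apply: gcoef_inj => h.
have -> : (\sum_(g <- gsupp f) f g *: gelt g) h =
    \sum_(g <- gsupp f) f g * (h == g)%:R.
  by elim/big_ind2: _ => // x u y v xu yv; rewrite gcoefD xu yv.
have [hf|] := boolP (h \in gsupp f); last first.
  rewrite mem_gsupp negbK => fh0; rewrite (eqP fh0) big1_seq // => g.
  move=> /= hg; have [gh|_] := eqVneq h g; last by rewrite mulr0.
  by rewrite -gh mem_gsupp fh0 in hg.
rewrite (big_fsetD1 h) //= eqxx mulr1 big1_seq ?addr0 // => g /=.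
by rewrite !inE eq_sym => /andP[/negPf ->]; rewrite mulr0.
Qed.

Lemma grpalg_ind (P : grpalg -> Prop) : P 0 ->
  (forall c g f, P f -> P (c *: gelt g + f)) -> forall f, P f.
Proof.
by move=> P0 PS f; rewrite (grpalgE f); elim/big_rec: _ => // g x _; apply: PS.
Qed.

(* (\sum_g a_g g) (\sum_h b_h h) = \sum_(g, h) a_g b_h gh *)
Definition gmul a b : grpalg :=
  glift (fun g => glift (fun h => gelt (g * h)%g) b) a.

Definition gone : grpalg := gelt 1%g.

Fact gstar_subproof f : finsupp_pred (fun g => (f g^-1%g)^*).
Proof.
apply/asboolP.
apply: (sub_finite_set _ (finite_image (fun g => g^-1%g) (asboolP _ (gcoefP f)))).
move=> g /= fg; exists g^-1%g; last by rewrite invgK.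
by apply: contra_neq fg => ->; rewrite conjc0.
Qed.

(* (\sum_g a_g g)^* = \sum_g conj(a_g) g^-1 *)
Definition gstar f : grpalg := GrpAlg (gstar_subproof f).

Lemma gmulZDl c a b f : gmul (c *: a + b) f = c *: gmul a f + gmul b f.
Proof. exact: linearP. Qed.

Lemma gmul0l f : gmul 0 f = 0.
Proof. exact: linear0. Qed.

Lemma gmulZDr c a b f : gmul f (c *: a + b) = c *: gmul f a + gmul f b.
Proof.
have gmulE x : gmul f x =
  \sum_(g <- gsupp f) f g *: glift (fun h => gelt (g * h)%g) x by [].
rewrite !gmulE scaler_sumr -big_split.
apply: eq_bigr => g _.
by rewrite linearP scalerDr !scalerA mulrC.
Qed.

Lemma gmul0r f : gmul f 0 = 0.
Proof. by have := gmulZDr (-1) 0 0 f; rewrite !scaleN1r !addNr. Qed.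

Lemma gmul_gelt g h : gmul (gelt g) (gelt h) = gelt (g * h)%g.
Proof. by rewrite /gmul !glift_gelt. Qed.

Let gmul_assoc_unit :
  [/\ associative gmul, left_id gone gmul & right_id gone gmul].
Proof.
move: gmulZDl gmulZDr gmul0l gmul0r gmul_gelt; rewrite /gone.
move: gmul => m mZDl mZDr m0l m0r mg; split.
- move=> x y z; elim/grpalg_ind: x => [|c g x IH]; first by rewrite !m0l.
  rewrite !mZDl IH; congr (_ *: _ + _).
  elim/grpalg_ind: y {IH x} => [|d h y IH]; first by rewrite !(m0l, m0r).
  rewrite mZDl !mZDr mZDl IH; congr (_ *: _ + _).
  elim/grpalg_ind: z {IH y} => [|e k z IH]; first by rewrite !m0r.
  by rewrite !mZDr IH !mg mulgA.
- elim/grpalg_ind => [|c g x IH]; first by rewrite m0r.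
  by rewrite mZDr IH mg mul1g.
- elim/grpalg_ind => [|c g x IH]; first by rewrite m0l.
  by rewrite mZDl IH mg mulg1.
Qed.

Let gmulA : associative gmul. Proof. by case: gmul_assoc_unit. Qed.
Let gmul1l : left_id gone gmul. Proof. by case: gmul_assoc_unit. Qed.
Let gmul1r : right_id gone gmul. Proof. by case: gmul_assoc_unit. Qed.

Let gmulDl : left_distributive gmul +%R.
Proof. by move=> x y z; have := gmulZDl 1 x y z; rewrite !scale1r. Qed.

Let gmulDr : right_distributive gmul +%R.
Proof. by move=> x y z; have := gmulZDr 1 y z x; rewrite !scale1r. Qed.

Let gone_neq0 : gone != 0.
Proof.
apply/eqP => /(congr1 (fun f : grpalg => f 1%g)); rewrite gelt_coef eqxx gcoef0.
by move/eqP; rewrite oner_eq0.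
Qed.

HB.instance Definition _ := GRing.Zmodule_isNzRing.Build grpalg
  gmulA gmul1l gmul1r gmulDl gmulDr gone_neq0.

Let gmulAl c a b : c *: (a * b) = (c *: a) * b.
Proof. by have := gmulZDl c a 0 b; rewrite gmul0l !addr0 => /esym. Qed.

Let gmulAr c a b : c *: (a * b) = a * (c *: b).
Proof. by have := gmulZDr c b 0 a; rewrite gmul0r !addr0 => /esym. Qed.

HB.instance Definition _ := GRing.Lmodule_isLalgebra.Build C grpalg gmulAl.
HB.instance Definition _ := GRing.Lalgebra_isAlgebra.Build C grpalg gmulAr.

Lemma gelt1 : gelt 1%g = 1. Proof. by []. Qed.

Lemma geltM g h : gelt (g * h)%g = gelt g * gelt h.
Proof. by rewrite -gmul_gelt. Qed.

Lemma gstarE f g : gstar f g = (f g^-1%g)^*. Proof. by []. Qed.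

Let gstarK : involutive gstar.
Proof. by move=> f; apply: gcoef_inj => g; rewrite !gstarE invgK conjcK. Qed.

Let gstarD : {morph gstar : a b / a + b}.
Proof. by move=> a b; apply: gcoef_inj => g; rewrite gcoefD !gstarE gcoefD rmorphD. Qed.

Let gstarZ c a : gstar (c *: a) = c^* *: gstar a.
Proof. by apply: gcoef_inj => g; rewrite gcoefZ !gstarE gcoefZ rmorphM. Qed.

Let gstar_gelt g : gstar (gelt g) = gelt g^-1%g.
Proof.
apply: gcoef_inj => h; rewrite gstarE !gelt_coef conjc_nat; congr (_%:R).
by rewrite -(inj_eq invg_inj) invgK.
Qed.

Let gstar0 : gstar 0 = 0.
Proof. by apply: gcoef_inj => h; rewrite gstarE gcoef0 conjc0. Qed.

Let gstarM a b : gstar (gmul a b) = gmul (gstar b) (gstar a).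
Proof.
move: gstarD gstarZ gstar0 gstar_gelt; move: gstar => s sD sZ s0 sg.
move: gmulZDl gmulZDr gmul0l gmul0r gmul_gelt.
move: gmul => m mZDl mZDr m0l m0r mg.
elim/grpalg_ind: a => [|c g a IH]; first by rewrite m0l s0 m0r.
rewrite mZDl !sD !sZ mZDr IH; congr (_ *: _ + _).
elim/grpalg_ind: b {a IH} => [|d h b IH]; first by rewrite m0r s0 m0l.
rewrite mZDr !sD !sZ mZDl IH; congr (_ *: _ + _).
by rewrite mg !sg mg invgM.
Qed.

HB.instance Definition _ := isStarAlgebra.Build R grpalg
  gstarK gstarD gstarZ gstarM.

Lemma star_gelt g : star (gelt g) = gelt g^-1%g :> grpalg.
Proof. exact: gstar_gelt. Qed.

Definition augmentation f : R[i] := glift (fun _ => 1 : R[i]^o) f.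

Lemma augmentationZD c f x :
  augmentation (c *: f + x) = c * augmentation f + augmentation x.
Proof. exact: linearP. Qed.

Lemma augmentation0 : augmentation 0 = 0.
Proof. exact: linear0. Qed.

Lemma augmentation_gelt g : augmentation (gelt g) = 1.
Proof. exact: glift_gelt. Qed.

Lemma augmentationM : {morph augmentation : x y / x * y}.
Proof.
move=> x y.
move: augmentationZD augmentation0 augmentation_gelt.
move: augmentation => e eZD e0 eg.
elim/grpalg_ind: x => [|c g x IH]; first by rewrite mul0r !e0 mul0r.
rewrite [in LHS]mulrDl -scalerAl !eZD IH mulrDl -mulrA; congr (_ * _ + _).
elim/grpalg_ind: y {IH x} => [|d h y IH]; first by rewrite mulr0 !e0 mulr0.
by rewrite [in LHS]mulrDr -scalerAr !eZD IH -geltM !eg !mulr1 !mul1r.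
Qed.

Lemma augmentation_star x : augmentation (star x) = (augmentation x)^*.
Proof.
move: augmentationZD augmentation0 augmentation_gelt.
move: augmentation => e eZD e0 eg.
elim/grpalg_ind: x => [|c g x IH].
  by rewrite [star 0]gstar0 e0 conjc0.
by rewrite starD starZ !eZD IH star_gelt !eg !mulr1 rmorphD.
Qed.

End GroupAlgebra.

Section Seminorms.
Variables (R : realType) (A : starAlgType R).

Record is_cstar_seminorm (p : A -> R) : Prop := IsCstarSeminorm {
  csnormD : forall x y, p (x + y) <= p x + p y;
  csnormZ : forall (c : R[i]) x, p (c *: x) = normc c * p x;
  csnormM : forall x y, p (x * y) <= p x * p y;
  csnorm_star : forall x, p (star x * x) = p x ^+ 2 }.

Section SeminormTheory.
Variables (p : A -> R) (p_csn : is_cstar_seminorm p).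

Lemma csnorm0 : p 0 = 0.
Proof. by rewrite -(scale0r 0) csnormZ // normc0 mul0r. Qed.

Lemma csnormN x : p (- x) = p x.
Proof. by rewrite -scaleN1r csnormZ // normcN normc1 mul1r. Qed.

Lemma csnorm_ge0 x : 0 <= p x.
Proof.
have := csnormD p_csn x (- x); rewrite subrr csnorm0 csnormN -mulr2n.
by rewrite pmulrn_lge0.
Qed.

End SeminormTheory.

End Seminorms.

(* The largest C*-seminorm on A, provided the supremum is finite.  By the
   Gelfand-Naimark theorem applied to the completion of A for each C*-seminorm,
   it is also the supremum of the norms of x under all *-representations of A
   on Hilbert spaces. *)
Definition max_cstar_norm (R : realType) (A : starAlgType R) (x : A) : R :=
  sup [set p x | p in @is_cstar_seminorm R A].

HB.mixin Record isPreCstar (R : realType) A of StarAlgebra R A := {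
  cnorm : A -> R;
  cnorm_seminorm : @is_cstar_seminorm R A cnorm;
  cnorm1 : cnorm 1 = 1
}.

#[short(type="preCstarType")]
HB.structure Definition PreCstar (R : realType) :=
  { A of isPreCstar R A & StarAlgebra R A }.

Section GroupAlgebraNorm.
Variables (R : realType) (G : groupType).
Local Notation CG := (grpalg R G).
Implicit Types (x y f : CG).

Lemma normc_ge0 (c : R[i]) : 0 <= normc c.
Proof. by case: c => a b; apply: sqrtr_ge0. Qed.

Lemma normcJ (c : R[i]) : normc c^* = normc c.
Proof. by case: c => a b; rewrite /normc /= sqrrN. Qed.

Definition gl1norm f : R := \sum_(g <- gsupp f) normc (f g).

Section Bound.
Variables (p : CG -> R) (p_csn : is_cstar_seminorm p).

Lemma csnorm_one_le1 : p 1 <= 1.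
Proof.
have := csnorm_star p_csn 1; rewrite mulr1 -gelt1 star_gelt invg1 gelt1 => p1.
have [//|lt1] := leP (p 1) 1.
have : p 1 < p 1 ^+ 2 by rewrite expr2 ltr_pMr // (lt_trans ltr01).
by rewrite -p1 ltxx.
Qed.

Lemma csnorm_gelt_le1 g : p (gelt R g) <= 1.
Proof.
rewrite -(@ler_pXn2r _ 2) ?nnegrE ?csnorm_ge0 // expr1n.
by rewrite -csnorm_star // star_gelt -geltM mulVg gelt1 csnorm_one_le1.
Qed.

Lemma csnorm_le_l1 f : p f <= gl1norm f.
Proof.
rewrite {1}(grpalgE f) /gl1norm.
elim/big_rec2: _ => [|g u v _ uv]; first by rewrite csnorm0.
rewrite (le_trans (csnormD p_csn _ _)) // lerD // csnormZ //.
by rewrite ler_piMr ?normc_ge0 // csnorm_gelt_le1.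
Qed.

End Bound.

Lemma augmentation_csn : is_cstar_seminorm (fun f => normc (augmentation f)).
Proof.
split=> [x y|c x|x y|x].
- by rewrite -(scale1r x) augmentationZD mul1r scale1r le_normcD.
- by rewrite -[c *: x]addr0 augmentationZD augmentation0 addr0 normcM.
- by rewrite augmentationM normcM.
- by rewrite augmentationM augmentation_star normcM normcJ.
Qed.

Definition full_norm f : R := max_cstar_norm f.

Let full_has_sup f : has_sup [set p f | p in @is_cstar_seminorm R CG].
Proof.
split.
  by exists (normc (augmentation f)), (fun x => normc (augmentation x));
    first exact: augmentation_csn.
by exists (gl1norm f) => _ [p p_csn <-]; apply: csnorm_le_l1.
Qed.

Lemma csnorm_le_full (p : CG -> R) f : is_cstar_seminorm p -> p f <= full_norm f.
Proof. by move=> p_csn; apply: ub_le_sup; [case: (full_has_sup f)|exists p]. Qed.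

Lemma full_norm_le f (r : R) :
  (forall p, is_cstar_seminorm p -> p f <= r) -> full_norm f <= r.
Proof.
move=> ler; apply: ge_sup; first by case: (full_has_sup f).
by move=> _ [p p_csn <-]; apply: ler.
Qed.

Let full_ge0 f : 0 <= full_norm f.
Proof. exact: le_trans (normc_ge0 _) (csnorm_le_full f augmentation_csn). Qed.

Let fullZ_le c f : full_norm (c *: f) <= normc c * full_norm f.
Proof.
apply: full_norm_le => p p_csn; rewrite csnormZ // ler_wpM2l ?normc_ge0 //.
exact: csnorm_le_full.
Qed.

Lemma full_norm_seminorm : is_cstar_seminorm full_norm.
Proof.
split=> [x y|c x|x y|x].
- apply: full_norm_le => p p_csn; apply: (le_trans (csnormD p_csn x y)).
  by apply: lerD; apply: csnorm_le_full.
- apply/eqP; rewrite eq_le fullZ_le /=.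
  have [->|c0] := eqVneq c 0; first by rewrite normc0 mul0r full_ge0.
  have nc0 : 0 < normc c.
    by rewrite lt_neqAle normc_ge0 andbT eq_sym; apply: contra_neq c0 => /eq0_normc.
  rewrite -ler_pdivlMl // -normcV -{1}(scale1r x) -(mulVf c0) -scalerA.
  exact: fullZ_le.
- apply: full_norm_le => p p_csn; apply: (le_trans (csnormM p_csn x y)).
  by apply: ler_pM; rewrite ?(csnorm_ge0 p_csn) ?csnorm_le_full.
- apply/eqP; rewrite eq_le; apply/andP; split.
    apply: full_norm_le => p p_csn; rewrite csnorm_star //.
    by apply: lerXn2r; rewrite ?nnegrE ?(csnorm_ge0 p_csn) ?full_ge0 ?csnorm_le_full.
  rewrite -[leRHS]sqr_sqrtr ?full_ge0 //.
  apply: lerXn2r; rewrite ?nnegrE ?sqrtr_ge0 ?full_ge0 //.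
  apply: full_norm_le => p p_csn.
  rewrite -(ger0_norm (csnorm_ge0 p_csn x)) -sqrtr_sqr -csnorm_star //.
  by rewrite ler_wsqrtr // csnorm_le_full.
Qed.

Lemma full_norm1 : full_norm 1 = 1.
Proof.
apply/eqP; rewrite eq_le; apply/andP; split.
  by apply: full_norm_le => p; apply: csnorm_one_le1.
apply: le_trans (csnorm_le_full 1 augmentation_csn).
by rewrite -gelt1 augmentation_gelt normc1.
Qed.

HB.instance Definition _ := isPreCstar.Build R CG full_norm_seminorm full_norm1.

End GroupAlgebraNorm.

Section Sequences.
Variables (R : realType) (V : zmodType) (N : V -> R).

Definition seq_cauchy (u : nat -> V) : Prop :=
  forall e : R, 0 < e ->
    exists n0, forall m n, (n0 <= m)%N -> (n0 <= n)%N -> N (u m - u n) < e.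

Definition seq_lim (u : nat -> V) (l : V) : Prop :=
  forall e : R, 0 < e -> exists n0, forall n, (n0 <= n)%N -> N (u n - l) < e.

End Sequences.

HB.mixin Record isCstarAlgebra (R : realType) A of PreCstar R A := {
  cnorm_eq0 : forall x : A, cnorm x = 0 -> x = 0;
  cnorm_complete : forall u : nat -> A,
    seq_cauchy (@cnorm R A) u -> exists l, seq_lim (@cnorm R A) u l
}.

#[short(type="cstarAlgType")]
HB.structure Definition CstarAlgebra (R : realType) :=
  { A of isCstarAlgebra R A & PreCstar R A }.

Section PreCstarTheory.
Variables (R : realType) (A : preCstarType R).
Implicit Types x y : A.
Local Notation N := (@cnorm R A).
Let csn := @cnorm_seminorm R A.

Lemma cnormD x y : N (x + y) <= N x + N y. Proof. exact: csnormD. Qed.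
Lemma cnormZ (c : R[i]) x : N (c *: x) = normc c * N x. Proof. exact: csnormZ. Qed.
Lemma cnormM x y : N (x * y) <= N x * N y. Proof. exact: csnormM. Qed.
Lemma cnorm_starM x : N (star x * x) = N x ^+ 2. Proof. exact: csnorm_star. Qed.
Lemma cnorm_ge0 x : 0 <= N x. Proof. exact: csnorm_ge0. Qed.
Lemma cnorm0 : N 0 = 0. Proof. exact: csnorm0. Qed.
Lemma cnormN x : N (- x) = N x. Proof. exact: csnormN. Qed.
Lemma cnormB x y : N (x - y) = N (y - x). Proof. by rewrite -cnormN opprB. Qed.

Lemma cnorm_triangle z x y : N (x - y) <= N (x - z) + N (z - y).
Proof. by rewrite (le_trans _ (cnormD _ _)) // addrA subrK. Qed.

Lemma cnorm_dist x y : `|N x - N y| <= N (x - y).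
Proof.
have le_sub u v : N u - N v <= N (u - v).
  by rewrite lerBlDr (le_trans _ (cnormD _ _)) // subrK.
by rewrite ler_norml le_sub andbT lerNl opprB cnormB le_sub.
Qed.

Lemma cnorm_star x : N (star x) = N x.
Proof.
have le_star y : N y <= N (star y).
  have [->|Ny0] := eqVneq (N y) 0; first exact: cnorm_ge0.
  have Ny : 0 < N y by rewrite lt_neqAle eq_sym Ny0 cnorm_ge0.
  by rewrite -(ler_pM2r Ny) -expr2 -cnorm_starM cnormM.
by apply/eqP; rewrite eq_le le_star andbT -{2}(starK x) le_star.
Qed.

Definition is_cauchy (u : nat -> A) : bool := `[< seq_cauchy N u >].

Lemma cauchy_bounded u : seq_cauchy N u -> exists2 B : R, 0 < B & forall n, N (u n) <= B.
Proof.
move=> /(_ 1 ltr01)[n0 un0].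
exists (1 + \sum_(i < n0.+1) N (u i)).
  by rewrite ltr_wpDr // sumr_ge0 // => i _; apply: cnorm_ge0.
move=> n; have [nn0|n0n] := ltnP n n0.+1.
  rewrite (bigD1 (Ordinal nn0)) //= addrCA lerDl addr_ge0 //.
  by rewrite sumr_ge0 // => i _; apply: cnorm_ge0.
rewrite -(subrK (u n0) (u n)) (le_trans (cnormD _ _)) // lerD //.
  by rewrite ltW // un0 // ltnW.
rewrite (bigD1 ord_max) //= lerDl.
by rewrite sumr_ge0 // => i _; apply: cnorm_ge0.
Qed.

Lemma seq_cauchy_cst x : seq_cauchy N (fun=> x).
Proof. by move=> e e0; exists 0%N => m n _ _; rewrite subrr cnorm0. Qed.

Lemma seq_cauchyD u v : seq_cauchy N u -> seq_cauchy N v -> seq_cauchy N (u + v).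
Proof.
move=> cu cv e e0; have e2 : 0 < e / 2 by rewrite divr_gt0.
have [n1 un1] := cu _ e2; have [n2 vn2] := cv _ e2.
exists (maxn n1 n2) => m n; rewrite !geq_max => /andP[m1 m2] /andP[n1' n2'].
rewrite [e]splitr opprD addrACA (le_lt_trans (cnormD _ _)) //.
by rewrite ltrD ?un1 ?vn2.
Qed.

Lemma seq_cauchyM u v : seq_cauchy N u -> seq_cauchy N v -> seq_cauchy N (u * v).
Proof.
move=> cu cv e e0.
have [B B0 uB] := cauchy_bounded cu; have [D D0 vD] := cauchy_bounded cv.
have eB : 0 < e / 2 / B by rewrite !divr_gt0.
have eD : 0 < e / 2 / D by rewrite !divr_gt0.
have [n1 un1] := cu _ eD; have [n2 vn2] := cv _ eB.
exists (maxn n1 n2) => m n; rewrite !geq_max => /andP[m1 m2] /andP[n1' n2'].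
have -> : (u * v) m - (u * v) n = (u m - u n) * v m + u n * (v m - v n).
  by rewrite mulrBl mulrBr addrA subrK.
rewrite [e]splitr (le_lt_trans (cnormD _ _)) // ltrD //.
  rewrite (le_lt_trans (cnormM _ _)) // -(divfK (lt0r_neq0 D0) (e / 2)).
  by rewrite (le_lt_trans (ler_wpM2l (cnorm_ge0 _) (vD m))) // ltr_pM2r // un1.
rewrite (le_lt_trans (cnormM _ _)) // -(divfK (lt0r_neq0 B0) (e / 2)) [ltRHS]mulrC.
by rewrite (le_lt_trans (ler_wpM2r (cnorm_ge0 _) (uB n))) // ltr_pM2l // vn2.
Qed.

Lemma seq_cauchy_star u : seq_cauchy N u -> seq_cauchy N (fun n => star (u n)).
Proof.
move=> cu e /cu[n0 un0]; exists n0 => m n mn0 nn0.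
suff -> : star (u m) - star (u n) = star (u m - u n) by rewrite cnorm_star un0.
by rewrite -scaleN1r starD -[- u n]scaleN1r starZ rmorphN rmorph1.
Qed.

Record cauchyseq := CauchySeq { cseq :> nat -> A; cseqP : is_cauchy cseq }.

HB.instance Definition _ := [isSub for cseq].
HB.instance Definition _ := [Choice of cauchyseq by <:].

Lemma seq_cauchyZ (c : R[i]) u : seq_cauchy N u -> seq_cauchy N (c *: u).
Proof.
move=> cu; have -> : c *: u = (fun=> c *: 1) * u.
  by apply/funext => n; rewrite /GRing.mul /= -scalerAl mul1r.
by apply: seq_cauchyM => //; apply: seq_cauchy_cst.
Qed.

Let cauchy_subring : GRing.subring_closed is_cauchy.
Proof.
split=> [|u v /asboolP cu /asboolP cv|u v /asboolP cu /asboolP cv]; apply/asboolP.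
- exact: seq_cauchy_cst.
- by rewrite -scaleN1r; apply/seq_cauchyD/seq_cauchyZ.
- exact: seq_cauchyM.
Qed.

HB.instance Definition _ :=
  GRing.SubChoice_isSubNzRing.Build _ _ cauchyseq cauchy_subring.

Let cauchy_submod : GRing.subsemimod_closed is_cauchy.
Proof.
split; first split=> [|u v /asboolP cu /asboolP cv]; last first.
- by move=> c u /asboolP cu; apply/asboolP/seq_cauchyZ.
- exact/asboolP/seq_cauchyD.
- exact/asboolP/seq_cauchy_cst.
Qed.

HB.instance Definition _ :=
  GRing.SubZmodule_isSubLmodule.Build _ _ _ cauchyseq cauchy_submod.

Implicit Types u v w : cauchyseq.

Definition cstarseq u : cauchyseq :=
  CauchySeq (asboolT (seq_cauchy_star (asboolP _ (cseqP u)))).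

Definition cconst x : cauchyseq := CauchySeq (asboolT (seq_cauchy_cst x)).

Definition is_null u : bool := `[< seq_lim N u 0 >].

Lemma is_nullP u : reflect (forall e, 0 < e -> exists n0, forall n, (n0 <= n)%N -> N (u n) < e)
  (is_null u).
Proof.
by apply: (iffP (asboolP _)) => nu e /nu[n0 un0]; exists n0 => n /un0; rewrite subr0.
Qed.

Let is_null_zmod : GRing.zmod_closed is_null.
Proof.
split=> [|u v /is_nullP nu /is_nullP nv]; apply/is_nullP => e e0.
  by exists 0%N => n _; rewrite cnorm0.
have e2 : 0 < e / 2 by rewrite divr_gt0.
have [n1 un1] := nu _ e2; have [n2 vn2] := nv _ e2.
exists (maxn n1 n2) => n; rewrite geq_max => /andP[n1' n2'].
by rewrite [e]splitr (le_lt_trans (cnormD _ _)) // cnormN ltrD ?un1 ?vn2.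
Qed.

HB.instance Definition _ := GRing.isZmodClosed.Build cauchyseq is_null is_null_zmod.

Definition null_ideal : zmodClosed cauchyseq :=
  GRing.ZmodClosed.clone cauchyseq is_null _.

Definition completion : Type := Quotient.quot null_ideal.
HB.instance Definition _ := GRing.Zmodule.on completion.

Definition cclass u : completion := \pi_(Quotient.quot null_ideal)%qT u.
Definition crepr (X : completion) : cauchyseq :=
  generic_quotient.repr (X : Quotient.quot null_ideal).

Implicit Types X Y Z : completion.

Lemma creprK X : cclass (crepr X) = X.
Proof. exact: generic_quotient.reprK. Qed.

Lemma cclass_ind (P : completion -> Prop) : (forall u, P (cclass u)) -> forall X, P X.
Proof. by move=> Pc X; rewrite -(creprK X). Qed.

Lemma cclassP u v : reflect (cclass u = cclass v) (is_null (u - v)).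
Proof.
have -> : is_null (u - v) = (u - v \in (null_ideal : {pred _})) by [].
by rewrite (Quotient.idealrBE null_ideal); apply: eqP.
Qed.

Lemma cclassD u v : cclass (u + v) = cclass u + cclass v.
Proof. exact: (Quotient.pi_add null_ideal). Qed.

Lemma cclass0 : cclass 0 = 0.
Proof. by apply: (@addrI _ (cclass 0)); rewrite -cclassD !addr0. Qed.

Lemma cclass_crepr u : is_null (u - crepr (cclass u)).
Proof. by apply/cclassP; rewrite creprK. Qed.

Let null_mulr u v : is_null u -> is_null (u * v).
Proof.
move=> /is_nullP nu; apply/is_nullP => e e0.
have [B B0 vB] := cauchy_bounded (asboolP _ (cseqP v)).
have [n0 un0] := nu _ (divr_gt0 e0 B0); exists n0 => n /un0 un.
rewrite (le_lt_trans (cnormM _ _)) // -(divfK (lt0r_neq0 B0) e).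
by rewrite (le_lt_trans (ler_wpM2l (cnorm_ge0 _) (vB n))) // ltr_pM2r.
Qed.

Let null_mull u v : is_null v -> is_null (u * v).
Proof.
move=> /is_nullP nv; apply/is_nullP => e e0.
have [B B0 uB] := cauchy_bounded (asboolP _ (cseqP u)).
have [n0 vn0] := nv _ (divr_gt0 e0 B0); exists n0 => n /vn0 vn.
rewrite (le_lt_trans (cnormM _ _)) // -(divfK (lt0r_neq0 B0) e) [ltRHS]mulrC.
by rewrite (le_lt_trans (ler_wpM2r (cnorm_ge0 _) (uB n))) // ltr_pM2l.
Qed.

Let null_scale (c : R[i]) u : is_null u -> is_null (c *: u).
Proof.
move=> nu; have -> : c *: u = cconst (c *: 1) * u.
  apply/val_inj/funext => n; apply: etrans (_ : (c *: 1) * u n = _); last by [].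
  by rewrite -scalerAl mul1r.
exact: null_mull.
Qed.

Let null_star u : is_null u -> is_null (cstarseq u).
Proof.
move=> /is_nullP nu; apply/is_nullP => e /nu[n0 un0].
by exists n0 => n /un0; rewrite /= cnorm_star.
Qed.

Definition cmul X Y : completion := cclass (crepr X * crepr Y).
Definition cone : completion := cclass 1.
Definition cscale (c : R[i]) X : completion := cclass (c *: crepr X).
Definition cstar X : completion := cclass (cstarseq (crepr X)).

Lemma cclassM u v : cclass (u * v) = cmul (cclass u) (cclass v).
Proof.
apply/cclassP; set u' := crepr _; set v' := crepr _.
have -> : u * v - u' * v' = (u - u') * v + u' * (v - v').
  by rewrite mulrBl mulrBr addrA subrK.
by apply: (rpredD (S := null_ideal)); [apply: null_mulr|apply: null_mull]; apply: cclass_crepr.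
Qed.

Lemma cclassZ c u : cclass (c *: u) = cscale c (cclass u).
Proof. by apply/cclassP; rewrite -scalerBr; apply/null_scale/cclass_crepr. Qed.

Lemma cstarseqD u v : cstarseq (u + v) = cstarseq u + cstarseq v.
Proof. by apply/val_inj/funext => n; apply: starD. Qed.

Lemma cstarseqZ c u : cstarseq (c *: u) = c^* *: cstarseq u.
Proof. by apply/val_inj/funext => n; apply: starZ. Qed.

Lemma cstarseqM u v : cstarseq (u * v) = cstarseq v * cstarseq u.
Proof. by apply/val_inj/funext => n; apply: starM. Qed.

Let cstarseqK : involutive cstarseq.
Proof. by move=> u; apply/val_inj/funext => n; apply: starK. Qed.

Lemma cclass_star u : cclass (cstarseq u) = cstar (cclass u).
Proof.
apply/cclassP; set u' := crepr _.
have -> : cstarseq u - cstarseq u' = cstarseq (u - u').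
  by rewrite -scaleN1r -[- u']scaleN1r cstarseqD cstarseqZ rmorphN rmorph1.
exact/null_star/cclass_crepr.
Qed.

Let cmulA : associative cmul.
Proof.
elim/cclass_ind => u; elim/cclass_ind => v; elim/cclass_ind => w.
by rewrite -!cclassM mulrA.
Qed.

Let cmul1l : left_id cone cmul.
Proof. by elim/cclass_ind => u; rewrite -cclassM mul1r. Qed.

Let cmul1r : right_id cone cmul.
Proof. by elim/cclass_ind => u; rewrite -cclassM mulr1. Qed.

Let cmulDl : left_distributive cmul +%R.
Proof.
elim/cclass_ind => u; elim/cclass_ind => v; elim/cclass_ind => w.
by rewrite -!(cclassM, cclassD) mulrDl.
Qed.

Let cmulDr : right_distributive cmul +%R.
Proof.
elim/cclass_ind => u; elim/cclass_ind => v; elim/cclass_ind => w.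
by rewrite -!(cclassM, cclassD) mulrDr.
Qed.

Let cone_neq0 : cone != 0.
Proof.
apply/eqP; rewrite -cclass0 => /cclassP; rewrite subr0 => /is_nullP/(_ 1 ltr01)[n0].
by move/(_ n0 (leqnn _)); rewrite cnorm1 ltxx.
Qed.

HB.instance Definition _ := GRing.Zmodule_isNzRing.Build completion
  cmulA cmul1l cmul1r cmulDl cmulDr cone_neq0.

Let cscaleA c d X : cscale c (cscale d X) = cscale (c * d) X.
Proof. by elim/cclass_ind: X => u; rewrite -!cclassZ scalerA. Qed.

Let cscale1 : left_id 1 cscale.
Proof. by elim/cclass_ind => u; rewrite -cclassZ scale1r. Qed.

Let cscaleDr : right_distributive cscale +%R.
Proof.
move=> c; elim/cclass_ind => u; elim/cclass_ind => v.
by rewrite -!(cclassZ, cclassD) scalerDr.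
Qed.

Let cscaleDl X : {morph cscale^~ X : c d / c + d}.
Proof.
by elim/cclass_ind: X => u c d; rewrite -!cclassZ scalerDl cclassD.
Qed.

HB.instance Definition _ := GRing.Zmodule_isLmodule.Build R[i] completion
  cscaleA cscale1 cscaleDr cscaleDl.

Let cscaleAl (c : R[i]) X Y : c *: (X * Y) = (c *: X) * Y.
Proof.
elim/cclass_ind: X => u; elim/cclass_ind: Y => v.
rewrite -[_ * _ in LHS]cclassM -[LHS]cclassZ -[c *: cclass u]cclassZ -[RHS]cclassM.
congr cclass; apply/val_inj/funext => n; exact: scalerAl.
Qed.

Let cscaleAr (c : R[i]) X Y : c *: (X * Y) = X * (c *: Y).
Proof.
elim/cclass_ind: X => u; elim/cclass_ind: Y => v.
rewrite -[_ * _ in LHS]cclassM -[LHS]cclassZ -[c *: cclass v]cclassZ -[RHS]cclassM.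
congr cclass; apply/val_inj/funext => n; exact: scalerAr.
Qed.

HB.instance Definition _ := GRing.Lmodule_isLalgebra.Build R[i] completion cscaleAl.
HB.instance Definition _ := GRing.Lalgebra_isAlgebra.Build R[i] completion cscaleAr.

Let cstarK : involutive cstar.
Proof. by elim/cclass_ind => u; rewrite -!cclass_star cstarseqK. Qed.

Let cstarD : {morph cstar : X Y / X + Y}.
Proof.
elim/cclass_ind => u; elim/cclass_ind => v.
by rewrite -cclassD -!cclass_star cstarseqD cclassD.
Qed.

Let cstarZ (c : R[i]) X : cstar (c *: X) = c^* *: cstar X.
Proof.
elim/cclass_ind: X => u.
by rewrite -[c *: cclass u]cclassZ -!cclass_star cstarseqZ [LHS]cclassZ.
Qed.

Let cstarM X Y : cstar (X * Y) = cstar Y * cstar X.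
Proof.
elim/cclass_ind: X => u; elim/cclass_ind: Y => v.
by rewrite -[cclass u * _]cclassM -!cclass_star cstarseqM [LHS]cclassM.
Qed.

HB.instance Definition _ := isStarAlgebra.Build R completion
  cstarK cstarD cstarZ cstarM.

Lemma cauchy_norm_cvg u : cvg ((fun n => N (u n)) @ \oo).
Proof.
apply/cauchy_cvgP/cauchy_exP => e e0.
have [n0 un0] := asboolP _ (cseqP u) _ e0.
exists (N (u n0)); exists n0 => // n /= n0n.
by rewrite /ball /= (le_lt_trans (cnorm_dist _ _)) // un0.
Qed.

Definition completion_norm X : R := lim ((fun n => N (crepr X n)) @ \oo).

Lemma completion_normP u : (fun n => N (u n)) @ \oo --> completion_norm (cclass u).
Proof.
set v := crepr (cclass u).
have -> : (fun n => N (u n)) = (fun n => N (v n)) + (fun n => N (u n) - N (v n)).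
  by apply/funext => n; rewrite fctE addrC subrK.
rewrite -[X in _ --> X]addr0; apply: cvgD; first exact: cauchy_norm_cvg.
apply/cvgrPdist_lt => e e0; have [n0 un0] := is_nullP _ (cclass_crepr u) _ e0.
exists n0 => // n /= n0n; rewrite sub0r normrN.
exact: le_lt_trans (cnorm_dist _ _) (un0 _ n0n).
Qed.

Let completion_seminorm : is_cstar_seminorm completion_norm.
Proof.
split.
- elim/cclass_ind => u; elim/cclass_ind => v; rewrite -cclassD.
  apply: (ler_cvg_to (@completion_normP (u + v)) (cvgD (@completion_normP u) (@completion_normP v))).
  by exists 0%N => // n _; apply: cnormD.
- move=> c; elim/cclass_ind => u; rewrite -[c *: cclass u]cclassZ.
  apply: (cvg_unique _ (@completion_normP (c *: u))) => //.
  have -> : (fun n => N ((c *: u) n)) = (fun n => normc c * N (u n)).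
    by apply/funext => n; apply: cnormZ.
  by apply: cvgM; [exact: cvg_cst|exact: completion_normP].
- elim/cclass_ind => u; elim/cclass_ind => v; rewrite -[cclass u * _]cclassM.
  apply: (ler_cvg_to (@completion_normP (u * v)) (cvgM (@completion_normP u) (@completion_normP v))).
  by exists 0%N => // n _; apply: cnormM.
- elim/cclass_ind => u; rewrite -[star _]cclass_star -[_ * _]cclassM.
  apply: (cvg_unique _ (@completion_normP (cstarseq u * u))) => //.
  have -> : (fun n => N ((cstarseq u * u) n)) = (fun n => N (u n) * N (u n)).
    by apply/funext => n; rewrite -expr2 -cnorm_starM.
  by rewrite expr2; apply: cvgM; apply: completion_normP.
Qed.

Definition to_completion x : completion := cclass (cconst x).

Lemma completion_norm_to x : completion_norm (to_completion x) = N x.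
Proof.
apply: (cvg_unique _ (@completion_normP (cconst x))) => //.
exact: (@cvg_cst _ (N x)).
Qed.

Let completion_norm1 : completion_norm 1 = 1.
Proof.
rewrite -(@cnorm1 R A) -completion_norm_to; congr completion_norm.
by congr cclass; apply: val_inj.
Qed.

HB.instance Definition _ :=
  isPreCstar.Build R completion completion_seminorm completion_norm1.

Lemma completion_norm_eq0 X : completion_norm X = 0 -> X = 0.
Proof.
elim/cclass_ind: X => u u0; rewrite -cclass0; apply/cclassP; rewrite subr0.
have /cvgrPdist_lt nu := @completion_normP u; apply/is_nullP => e /nu[n0 _ un0].
by exists n0 => n /un0 /=; rewrite u0 sub0r normrN ger0_norm // cnorm_ge0.
Qed.

Lemma completion_normB x u (e : R) n0 : (forall n, (n0 <= n)%N -> N (u n - x) <= e) ->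
  completion_norm (cclass u - to_completion x) <= e.
Proof.
move=> ue.
have -> : cclass u - to_completion x = cclass (u - cconst x).
  by apply/eqP; rewrite subr_eq -cclassD subrK.
apply: (ler_cvg_to (@completion_normP (u - cconst x)) (cvg_cst e)).
by exists n0 => // n /= /ue.
Qed.

Lemma to_completion_dense X (e : R) : 0 < e ->
  exists x, completion_norm (X - to_completion x) <= e.
Proof.
elim/cclass_ind: X => u e0; have [n0 un0] := asboolP _ (cseqP u) _ e0.
by exists (u n0); apply: (completion_normB (n0 := n0)) => n n0n; rewrite ltW // un0.
Qed.

Lemma to_completionD x y : to_completion (x + y) = to_completion x + to_completion y.
Proof. by rewrite -cclassD; congr cclass; apply: val_inj. Qed.

Lemma to_completionB x y : to_completion (x - y) = to_completion x - to_completion y.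
Proof. by apply/eqP; rewrite eq_sym subr_eq -to_completionD subrK. Qed.

Lemma to_completionZ (c : R[i]) x : to_completion (c *: x) = c *: to_completion x.
Proof. by rewrite -[RHS]cclassZ; congr cclass; apply: val_inj. Qed.

Lemma to_completionM x y : to_completion (x * y) = to_completion x * to_completion y.
Proof. by rewrite -[RHS]cclassM; congr cclass; apply: val_inj. Qed.

Lemma to_completion1 : to_completion 1 = 1.
Proof. by congr cclass; apply: val_inj. Qed.

Lemma to_completion_star x : to_completion (star x) = star (to_completion x).
Proof. by rewrite -[RHS]cclass_star; congr cclass; apply: val_inj. Qed.

End PreCstarTheory.

Section CompletionComplete.
Variables (R : realType) (A : preCstarType R).
Local Notation N := (@cnorm R A).
Local Notation M := (@cnorm R (completion A)).

Lemma cnorm_to_completion (x : A) : M (to_completion x) = N x.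
Proof. exact: completion_norm_to. Qed.

Let completion_complete (U : nat -> completion A) :
  seq_cauchy M U -> exists L, seq_lim M U L.
Proof.
move=> cU.
have pos n : 0 < (n.+1%:R)^-1 :> R by rewrite invr_gt0 ltr0n.
have small (e : R) : 0 < e -> exists n0, forall n, (n0 <= n)%N -> n.+1%:R^-1 < e.
  move=> e0; have [n0 _ n0P] := near_infty_natSinv_lt (PosNum e0).
  by exists n0 => n /n0P.
have [x Ux] := choice (fun n => to_completion_dense (U n) (pos n)).
have cx : seq_cauchy N x.
  move=> e e0; have e3 : 0 < e / 3%:R by rewrite divr_gt0 ?ltr0n.
  have [n1 Un1] := cU _ e3; have [n2 n2P] := small _ e3.
  exists (maxn n1 n2) => m n; rewrite !geq_max => /andP[m1 m2] /andP[n1' n2'].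
  rewrite -cnorm_to_completion to_completionB.
  have -> : e = e / 3%:R + (e / 3%:R + e / 3%:R) by field.
  apply: le_lt_trans (cnorm_triangle (U m) _ _) _; apply: ltrD.
    by rewrite cnormB; apply: le_lt_trans (Ux m) (n2P _ m2).
  apply: le_lt_trans (cnorm_triangle (U n) _ _) _; apply: ltrD.
    exact: Un1.
  exact: le_lt_trans (Ux n) (n2P _ n2').
pose u := CauchySeq (asboolT cx).
exists (cclass u) => e e0; have e2 : 0 < e / 2 by rewrite divr_gt0.
have [n1 xn1] := cx _ e2; have [n2 n2P] := small _ e2.
exists (maxn n1 n2) => n; rewrite geq_max => /andP[n1' n2'].
rewrite [e]splitr; apply: le_lt_trans (cnorm_triangle (to_completion (x n)) _ _) _.
apply: ltr_leD; first exact: le_lt_trans (Ux n) (n2P _ n2').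
rewrite cnormB; apply: (@completion_normB _ _ _ u _ n1) => m n1m.
by apply/ltW/xn1.
Qed.

HB.instance Definition _ :=
  isCstarAlgebra.Build R (completion A) (@completion_norm_eq0 R A)
    completion_complete.

End CompletionComplete.

(* The norm of grpalg R G as a preCstarType is full_norm, its largest
   C*-seminorm. *)
Definition fullCstar (R : realType) (G : groupType) : cstarAlgType R :=
  completion (grpalg R G).

Definition gunit (R : realType) (G : groupType) (g : G) : fullCstar R G :=
  to_completion (gelt R g).

Lemma gunit1 (R : realType) (G : groupType) : gunit R (1%g : G) = 1.
Proof. exact: to_completion1. Qed.

Lemma gunitM (R : realType) (G : groupType) (g h : G) :
  gunit R (g * h)%g = gunit R g * gunit R h.
Proof. by rewrite -[RHS]to_completionM -geltM. Qed.

Lemma gunitV (R : realType) (G : groupType) (g : G) :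
  gunit R g^-1%g = star (gunit R g).
Proof. by rewrite -[RHS]to_completion_star star_gelt. Qed.

Lemma gunit_unitary (R : realType) (G : groupType) (g : G) :
  star (gunit R g) * gunit R g = 1 /\ gunit R g * star (gunit R g) = 1.
Proof. by rewrite -gunitV -!gunitM mulVg mulgV gunit1. Qed.

Section Matrices.
Variables (R : realType) (d : nat).

Definition vnorm (v : 'cV[R[i]]_d) : R :=
  Num.sqrt (\sum_(k < d) normc (v k 0) ^+ 2).

Definition opnorm (T : 'M[R[i]]_d) : R :=
  sup [set vnorm (T *m v) | v in [set v | vnorm v <= 1]].

Definition adjmx (T : 'M[R[i]]_d) : 'M[R[i]]_d := map_mx conjc T^T.

(* A *-homomorphism, not required to be unital. *)
Definition representation (A : cstarAlgType R) (pi : A -> 'M[R[i]]_d) : Prop :=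
  [/\ linear pi,
      forall x y, pi (x * y) = pi x *m pi y &
      forall x, pi (star x) = adjmx (pi x)].

End Matrices.

(* Main.v *)
Require Import Defs.
From mathcomp Require Import all_boot all_order all_algebra fingroup perm.
From mathcomp Require Import finmap complex.
From mathcomp Require Import ring.
From mathcomp Require Import all_classical all_reals all_analysis.

(** Put u = w2^-1 w1, a nontrivial reduced word of length l.  For a unitary
    representation pi of the free group on C^d,

      alpha pi(w1) + beta pi(w2) = pi(w2) (alpha pi(u) + beta),

    so if pi(u) v = lam v with v a unit vector, then v is sent to a vector of
    norm |alpha lam + beta|.  Since lam may be any number of modulus 1, the
    phases of alpha lam and beta can be aligned ([ex_aligning_phase]) and the
    norm |alpha| + |beta| is attained; it is an upper bound because pi(w1) and
    pi(w2) are isometries.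

    It remains to find unitaries, one for each generator, for which u has the
    prescribed eigenvalue lam; dimension l already suffices, and any larger one
    works as well ([reduced_eigen]).  If the last letter of u is not inverse to
    the first, write u around a cycle with l vertices.  As u is cyclically
    reduced, no two edges with the same label leave or enter the same vertex, so
    each generator acts on the vertices as a partial injection.  Extend these to
    permutations, giving the weight lam to one edge of the cycle and 1
    elsewhere: going once around the cycle multiplies a basis vector by lam
    ([cyclically_reduced_eigen]).  In general u is conjugate to such a word by
    cancelling outer letters, and conjugation preserves eigenvalues.

    Unitaries extend to the full C*-algebra because f |-> ||pi(f)|| is a
    C*-seminorm on the group algebra, hence is dominated by the largest one;
    pi then maps Cauchy sequences to Cauchy sequences of matrices, and the
    entrywise limit is the extension ([ex_fullCstar_extension]). *)

Import Order.TTheory GRing.Theory Num.Theory.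
Import numFieldNormedType.Exports.
Import ComplexField.Normc.

Local Open Scope ring_scope.
Local Open Scope complex_scope.

Set Implicit Arguments.
Unset Strict Implicit.
Unset Printing Implicit Defensive.

(** * The operator norm on complex matrices *)

Section OperatorNorm.
Variable R : realType.
Local Notation C := R[i].

Lemma sqr_sum_mul_le (I : finType) (a b : I -> R) :
  (\sum_i a i * b i) ^+ 2 <= (\sum_i a i ^+ 2) * (\sum_i b i ^+ 2).
Proof.
set A := \sum_i a i ^+ 2; set B := \sum_i b i ^+ 2; set c := \sum_i a i * b i.
have B_ge0 : 0 <= B by apply: sumr_ge0 => i _; apply: sqr_ge0.
have [B0|B_neq0] := eqVneq B 0.
  have b0 i : b i = 0.
    apply/eqP; rewrite -sqrf_eq0; apply/eqP.
    by apply: (psumr_eq0P _ B0) => // j _; apply: sqr_ge0.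
  by rewrite B0 mulr0 /c big1 ?expr0n // => i _; rewrite b0 mulr0.
have B_gt0 : 0 < B by rewrite lt_def B_neq0.
rewrite -subr_ge0 -(pmulr_rge0 _ B_gt0).
(* Expand the squared norm of B a - c b, which is B times the component of a
   orthogonal to b. *)
have -> : B * (A * B - c ^+ 2) = \sum_i (B * a i - c * b i) ^+ 2.
  transitivity (\sum_i (B ^+ 2 * a i ^+ 2 + (c ^+ 2 * b i ^+ 2 -
      (B * c *+ 2) * (a i * b i)))).
    by rewrite !big_split /= sumrN -!mulr_sumr -/A -/B -/c; ring.
  by apply: eq_bigr => i _; ring.
by apply: sumr_ge0 => i _; apply: sqr_ge0.
Qed.

Lemma mul_conjc_normc (z : C) : z^* * z = (normc z ^+ 2)%:C.
Proof.
case: z => a b; rewrite /normc sqr_sqrtr ?addr_ge0 ?sqr_ge0 //.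
by apply/eqP; rewrite eq_complex /=; apply/andP; split; apply/eqP; ring.
Qed.

Lemma normc_real (x : R) : normc x%:C = `|x|.
Proof. by rewrite /normc /= expr0n addr0 sqrtr_sqr. Qed.

Lemma Re_le_normc (z : C) : `|complex.Re z| <= normc z.
Proof.
by case: z => a b; rewrite /= -sqrtr_sqr ler_wsqrtr // lerDl sqr_ge0.
Qed.

Lemma Im_le_normc (z : C) : `|complex.Im z| <= normc z.
Proof.
by case: z => a b; rewrite /= -sqrtr_sqr ler_wsqrtr // lerDr sqr_ge0.
Qed.

Lemma normc_sum_le (I : finType) (F : I -> C) :
  normc (\sum_i F i) <= \sum_i normc (F i).
Proof.
elim/big_rec2: _ => [|i x y _ xy]; first by rewrite normc0.
by apply: le_trans (le_normcD _ _) _; rewrite lerD2l.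
Qed.

Lemma normc_sum_mul_le (I : finType) (a b : I -> C) :
  normc (\sum_i a i * b i) ^+ 2 <=
    (\sum_i normc (a i) ^+ 2) * (\sum_i normc (b i) ^+ 2).
Proof.
apply: le_trans (sqr_sum_mul_le _ _).
rewrite ler_pXn2r ?nnegrE ?normc_ge0 ?sumr_ge0 //; last first.
  by move=> i _; rewrite mulr_ge0 ?normc_ge0.
apply: le_trans (normc_sum_le _) _.
by apply: ler_sum => i _; rewrite normcM.
Qed.

Variable d : nat.
Implicit Types (u v : 'cV[C]_d) (S T : 'M[C]_d).

Definition dotmx u v : C := (map_mx conjc u^T *m v) 0 0.

Lemma vnorm_ge0 v : 0 <= vnorm v. Proof. exact: sqrtr_ge0. Qed.

Lemma sqr_vnorm v : vnorm v ^+ 2 = \sum_k normc (v k 0) ^+ 2.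
Proof. by rewrite sqr_sqrtr // sumr_ge0 // => i _; apply: sqr_ge0. Qed.

Lemma dotmxE u v : dotmx u v = \sum_k (u k 0)^* * v k 0.
Proof. by rewrite /dotmx mxE; apply: eq_bigr => k _; rewrite !mxE. Qed.

Lemma dotmx_self v : dotmx v v = (vnorm v ^+ 2)%:C.
Proof.
rewrite dotmxE sqr_vnorm rmorph_sum; apply: eq_bigr => k _.
exact: mul_conjc_normc.
Qed.

Lemma dotmx_adj T u v : dotmx (T *m u) v = dotmx u (adjmx T *m v).
Proof. by rewrite /dotmx /adjmx trmx_mul map_mxM mulmxA. Qed.

Lemma normc_dotmx_le u v : normc (dotmx u v) <= vnorm u * vnorm v.
Proof.
rewrite -(@ler_pXn2r _ 2) ?nnegrE ?normc_ge0 ?mulr_ge0 ?vnorm_ge0 //.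
rewrite exprMn !sqr_vnorm dotmxE.
apply: le_trans (normc_sum_mul_le _ _) _.
by under eq_bigr do rewrite Defs.normcJ.
Qed.

Lemma vnormZ (c : C) v : vnorm (c *: v) = normc c * vnorm v.
Proof.
apply/eqP; rewrite -(@eqrXn2 _ 2) ?mulr_ge0 ?vnorm_ge0 ?normc_ge0 //.
rewrite exprMn !sqr_vnorm mulr_sumr; apply/eqP; apply: eq_bigr => k _.
by rewrite mxE normcM exprMn.
Qed.

Lemma vnorm0 : vnorm (0 : 'cV[C]_d) = 0.
Proof. by rewrite -(scale0r 0) vnormZ normc0 mul0r. Qed.

Lemma vnorm_eq0 v : vnorm v = 0 -> v = 0.
Proof.
move=> v0; have := sqr_vnorm v; rewrite v0 expr0n => /esym sum0.
apply/matrixP => k j; rewrite ord1 mxE; apply: eq0_normc; apply/eqP.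
rewrite -sqrf_eq0; apply/eqP.
by apply: (psumr_eq0P _ sum0) => // i _; apply: sqr_ge0.
Qed.

Lemma vnormD u v : vnorm (u + v) <= vnorm u + vnorm v.
Proof.
rewrite -(@ler_pXn2r _ 2) ?nnegrE ?addr_ge0 ?vnorm_ge0 //.
have -> : vnorm (u + v) ^+ 2 = normc (dotmx (u + v) (u + v)).
  by rewrite dotmx_self normc_real ger0_norm ?sqr_ge0.
have -> : dotmx (u + v) (u + v) =
    dotmx u u + dotmx u v + (dotmx v u + dotmx v v).
  rewrite !dotmxE -!big_split /=; apply: eq_bigr => k _.
  by rewrite !mxE rmorphD mulrDl !mulrDr.
apply: le_trans (le_normcD _ _) _.
have -> : (vnorm u + vnorm v) ^+ 2 = vnorm u * vnorm u + vnorm u * vnorm v +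
    (vnorm v * vnorm u + vnorm v * vnorm v) by ring.
by apply: lerD; apply: le_trans (le_normcD _ _) _;
  apply: lerD; apply: normc_dotmx_le.
Qed.

(** Crude bound by the Frobenius norm; it only serves to show that the supremum
    defining [opnorm] is finite. *)
Lemma vnorm_mulmx_le T v :
  vnorm (T *m v) <= Num.sqrt (\sum_i \sum_j normc (T i j) ^+ 2) * vnorm v.
Proof.
have F0 : 0 <= \sum_i \sum_j normc (T i j) ^+ 2.
  by do 2![apply: sumr_ge0 => ? _]; apply: sqr_ge0.
rewrite -(@ler_pXn2r _ 2) ?nnegrE ?mulr_ge0 ?vnorm_ge0 ?sqrtr_ge0 //.
rewrite exprMn !sqr_vnorm sqr_sqrtr // mulr_suml; apply: ler_sum => i _.
by rewrite mxE; apply: normc_sum_mul_le.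
Qed.

Let opset T := [set vnorm (T *m v) | v in [set v | vnorm v <= 1]]%classic.

Let opset_has_sup T : has_sup (opset T).
Proof.
split; first by exists (vnorm (T *m 0)), 0 => //=; rewrite vnorm0.
exists (Num.sqrt (\sum_i \sum_j normc (T i j) ^+ 2)) => _ [v /= v1 <-].
apply: le_trans (vnorm_mulmx_le _ _) _.
by rewrite ler_piMr ?sqrtr_ge0.
Qed.

Lemma vnorm_le_opnorm T v : vnorm v <= 1 -> vnorm (T *m v) <= opnorm T.
Proof. by move=> v1; apply: ub_le_sup; [case: (opset_has_sup T)|exists v]. Qed.

Lemma opnorm_le T (r : R) :
  (forall v, vnorm v <= 1 -> vnorm (T *m v) <= r) -> opnorm T <= r.
Proof.
move=> Tr; apply: ge_sup; first by case: (opset_has_sup T).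
by move=> _ [v v1 <-]; apply: Tr.
Qed.

Lemma opnorm_ge0 T : 0 <= opnorm T.
Proof.
by apply: le_trans (@vnorm_le_opnorm T 0 _); rewrite ?vnorm_ge0 // vnorm0.
Qed.

Lemma vnorm_mulmx T v : vnorm (T *m v) <= opnorm T * vnorm v.
Proof.
have [v0|v0] := eqVneq (vnorm v) 0.
  by rewrite (vnorm_eq0 v0) mulmx0 vnorm0 mulr0.
have vv : normc (vnorm v)^-1%:C = (vnorm v)^-1.
  by rewrite normc_real ger0_norm // invr_ge0 vnorm_ge0.
have := @vnorm_le_opnorm T ((vnorm v)^-1%:C *: v).
rewrite -scalemxAr !vnormZ vv mulVf // => /(_ (lexx _)).
by rewrite ler_pdivrMl ?lt_def ?v0 ?vnorm_ge0 // mulrC.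
Qed.

Lemma opnormD S T : opnorm (S + T) <= opnorm S + opnorm T.
Proof.
apply: opnorm_le => v v1; rewrite mulmxDl.
by apply: le_trans (vnormD _ _) _; rewrite lerD ?vnorm_le_opnorm.
Qed.

Lemma opnormZ_le (c : C) T : opnorm (c *: T) <= normc c * opnorm T.
Proof.
apply: opnorm_le => v v1; rewrite -scalemxAl vnormZ.
by rewrite ler_wpM2l ?normc_ge0 ?vnorm_le_opnorm.
Qed.

Lemma opnormZ (c : C) T : opnorm (c *: T) = normc c * opnorm T.
Proof.
apply/eqP; rewrite eq_le opnormZ_le /=.
have [->|c0] := eqVneq c 0; first by rewrite normc0 mul0r opnorm_ge0.
have nc0 : 0 < normc c.
  by rewrite lt_def normc_ge0 andbT; apply: contra_neq c0 => /eq0_normc.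
rewrite -ler_pdivlMl // -normcV -{1}(scale1r T) -(mulVf c0) -scalerA.
exact: opnormZ_le.
Qed.

Lemma opnormM S T : opnorm (S *m T) <= opnorm S * opnorm T.
Proof.
apply: opnorm_le => v v1; rewrite -mulmxA.
apply: le_trans (vnorm_mulmx _ _) _.
by rewrite ler_wpM2l ?opnorm_ge0 ?vnorm_le_opnorm.
Qed.

Lemma adjmxK : involutive (@adjmx R d).
Proof. by move=> T; apply/matrixP => i j; rewrite !mxE conjcK. Qed.

(** This half of the C*-identity is Cauchy-Schwarz:
    ||T v||^2 = <v, T^* T v> <= ||T^* T|| for a unit vector v. *)
Lemma sqr_opnorm_le T : opnorm T ^+ 2 <= opnorm (adjmx T *m T).
Proof.
rewrite -[leRHS]sqr_sqrtr ?opnorm_ge0 // ler_pXn2r ?nnegrE ?opnorm_ge0 ?sqrtr_ge0 //.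
apply: opnorm_le => v v1.
rewrite -(ger0_norm (vnorm_ge0 (T *m v))) -sqrtr_sqr ler_wsqrtr //.
rewrite -[leLHS]ger0_norm ?sqr_ge0 // -normc_real -dotmx_self dotmx_adj.
apply: le_trans (normc_dotmx_le _ _) _.
rewrite -[leRHS]mul1r ler_pM ?vnorm_ge0 //.
by rewrite mulmxA vnorm_le_opnorm.
Qed.

(** Divide ||T||^2 <= ||T^* T|| <= ||T^*|| ||T|| by ||T||. *)
Lemma opnorm_adj_le T : opnorm T <= opnorm (adjmx T).
Proof.
have [T0|T0] := eqVneq (opnorm T) 0; first by rewrite T0 opnorm_ge0.
have T_gt0 : 0 < opnorm T by rewrite lt_def T0 opnorm_ge0.
rewrite -(ler_pM2r T_gt0) -expr2.
exact: le_trans (sqr_opnorm_le T) (opnormM _ _).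
Qed.

Lemma opnorm_adj T : opnorm (adjmx T) = opnorm T.
Proof.
apply/eqP; rewrite eq_le opnorm_adj_le andbT.
by have := opnorm_adj_le (adjmx T); rewrite adjmxK.
Qed.

Lemma opnorm_adjM T : opnorm (adjmx T *m T) = opnorm T ^+ 2.
Proof.
apply/eqP; rewrite eq_le sqr_opnorm_le andbT.
by rewrite expr2 -{1}(opnorm_adj T) opnormM.
Qed.

Lemma vnorm_isometry T v : adjmx T *m T = 1%:M -> vnorm (T *m v) = vnorm v.
Proof.
move=> TT; apply/eqP; rewrite -(@eqrXn2 _ 2) ?vnorm_ge0 //; apply/eqP.
apply: (@complexI R); apply: etrans (esym (dotmx_self _)) _.
by rewrite dotmx_adj mulmxA TT mul1mx dotmx_self.
Qed.

Lemma opnorm_isometry T : adjmx T *m T = 1%:M -> opnorm T <= 1.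
Proof. by move=> TT; apply: opnorm_le => v; rewrite vnorm_isometry. Qed.

Lemma vnorm_delta k : vnorm (delta_mx k 0 : 'cV[C]_d) = 1.
Proof.
rewrite /vnorm (bigD1 k) //= big1 => [|i ik].
  by rewrite mxE !eqxx normc1 expr1n addr0 sqrtr1.
by rewrite mxE (negPf ik) normc0 expr0n.
Qed.

Lemma normc_entry_le T i j : normc (T i j) <= opnorm T.
Proof.
apply: le_trans (@vnorm_le_opnorm T (delta_mx j 0) _); last by rewrite vnorm_delta.
rewrite -colE -(@ler_pXn2r _ 2) ?nnegrE ?normc_ge0 ?vnorm_ge0 //.
rewrite sqr_vnorm (bigD1 i) //= mxE lerDl sumr_ge0 // => k _.
exact: sqr_ge0.
Qed.

End OperatorNorm.

(** * Extending a unitary representation to the full group algebra *)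

Section ComplexLimits.
Variable R : realType.
Local Notation C := R[i].
Implicit Types (z w : nat -> C) (a b : C).
Local Open Scope classical_set_scope.

(** Convergence is stated on real and imaginary parts, so that completeness and
    the rules for limits are those of the real numbers. *)
Definition ccvg z a : Prop :=
  (fun n => complex.Re (z n)) @ \oo --> complex.Re a /\
  (fun n => complex.Im (z n)) @ \oo --> complex.Im a.

Lemma ccvg_cst a : ccvg (fun=> a) a.
Proof. by split; apply: cvg_cst. Qed.

Lemma ccvg_unique z a b : ccvg z a -> ccvg z b -> a = b.
Proof.
case: a b => [ar ai] [br bi] [/= zar zai] [/= zbr zbi].
by congr Complex; [apply: cvg_unique zar zbr|apply: cvg_unique zai zbi].
Qed.

Lemma ReD a b : complex.Re (a + b) = complex.Re a + complex.Re b.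
Proof. by case: a b => [? ?] []. Qed.

Lemma ImD a b : complex.Im (a + b) = complex.Im a + complex.Im b.
Proof. by case: a b => [? ?] []. Qed.

Lemma ReM a b : complex.Re (a * b) =
  complex.Re a * complex.Re b - complex.Im a * complex.Im b.
Proof. by case: a b => [? ?] []. Qed.

Lemma ImM a b : complex.Im (a * b) =
  complex.Re a * complex.Im b + complex.Im a * complex.Re b.
Proof. by case: a b => [? ?] []. Qed.

Lemma ccvgD z w a b : ccvg z a -> ccvg w b -> ccvg (fun n => z n + w n) (a + b).
Proof.
move=> [zr zi] [wr wi]; split.
  by rewrite ReD; under eq_fun do rewrite ReD; apply: cvgD.
by rewrite ImD; under eq_fun do rewrite ImD; apply: cvgD.
Qed.

Lemma ccvgM z w a b : ccvg z a -> ccvg w b -> ccvg (fun n => z n * w n) (a * b).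
Proof.
move=> [zr zi] [wr wi]; split.
  rewrite ReM; under eq_fun do rewrite ReM.
  by apply: cvgB; apply: cvgM.
rewrite ImM; under eq_fun do rewrite ImM.
by apply: cvgD; apply: cvgM.
Qed.

Lemma ccvg_sum (I : finType) (z : I -> nat -> C) (a : I -> C) :
  (forall k, ccvg (z k) (a k)) -> ccvg (fun n => \sum_k z k n) (\sum_k a k).
Proof.
move=> za; elim: (index_enum I) => [|k s IHs].
  by rewrite big_nil; under eq_fun do rewrite big_nil; apply: ccvg_cst.
by rewrite big_cons; under eq_fun do rewrite big_cons; apply: ccvgD.
Qed.

Lemma ccvg_conj z a : ccvg z a -> ccvg (fun n => (z n)^*) a^*.
Proof.
have ReJ b : complex.Re b^* = complex.Re b by case: b.
have ImJ b : complex.Im b^* = - complex.Im b by case: b.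
move=> [zr zi]; split.
  by rewrite ReJ; under eq_fun do rewrite ReJ.
by rewrite ImJ; under eq_fun do rewrite ImJ; apply: cvgN.
Qed.

Lemma ccvg0_norm z (e_ : nat -> R) : e_ @ \oo --> (0 : R) ->
  (forall n, normc (z n) <= e_ n) -> ccvg z 0.
Proof.
move=> e0 ze; have Ne0 : - e_ @ \oo --> (0 : R) by rewrite -oppr0; apply: cvgN.
split=> /=; (apply: squeeze_cvgr Ne0 e0; apply: nearW => n).
  by rewrite -ler_norml (le_trans (Re_le_normc _)).
by rewrite -ler_norml (le_trans (Im_le_normc _)).
Qed.

Lemma ccvg_cauchy z :
  (forall e : R, 0 < e -> exists n0, forall m n, (n0 <= m)%N -> (n0 <= n)%N ->
     normc (z m - z n) < e) -> exists a, ccvg z a.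
Proof.
move=> cz.
have part (f : C -> R) : (forall x, `|f x| <= normc x) ->
    (forall x y, f (x - y) = f x - f y) -> cvg ((f \o z) @ \oo).
  move=> fle fB; apply/cauchy_cvgP/cauchy_exP => e e0.
  have [n0 zn0] := cz _ e0; exists (f (z n0)); exists n0 => // n /= n0n.
  by rewrite /ball /= -fB (le_lt_trans (fle _)) // zn0.
have cr := part (@complex.Re R) (@Re_le_normc R)
  (fun x y => match x, y with a +i* b, c +i* d => erefl end).
have ci := part (@complex.Im R) (@Im_le_normc R)
  (fun x y => match x, y with a +i* b, c +i* d => erefl end).
by exists (lim ((@complex.Re R \o z) @ \oo) +i* lim ((@complex.Im R \o z) @ \oo)).
Qed.

End ComplexLimits.

Section MatrixLimits.
Variables (R : realType) (d : nat).
Local Notation C := R[i].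
Implicit Types (Sn Tn : nat -> 'M[C]_d) (S T : 'M[C]_d).

Definition mxcvg Tn T : Prop := forall i j, ccvg (fun n => Tn n i j) (T i j).

Lemma mxcvg_cst T : mxcvg (fun=> T) T.
Proof. by move=> i j; apply: ccvg_cst. Qed.

Lemma mxcvg_unique Tn S T : mxcvg Tn S -> mxcvg Tn T -> S = T.
Proof. by move=> TS TT; apply/matrixP => i j; apply: ccvg_unique (TS i j) (TT i j). Qed.

Lemma mxcvgD Sn Tn S T : mxcvg Sn S -> mxcvg Tn T ->
  mxcvg (fun n => Sn n + Tn n) (S + T).
Proof.
move=> SS TT i j; rewrite mxE; under eq_fun do rewrite mxE.
exact: ccvgD.
Qed.

Lemma mxcvgZ c Tn T : mxcvg Tn T -> mxcvg (fun n => c *: Tn n) (c *: T).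
Proof.
move=> TT i j; rewrite mxE; under eq_fun do rewrite mxE.
exact/ccvgM/TT/ccvg_cst.
Qed.

Lemma mxcvgM Sn Tn S T : mxcvg Sn S -> mxcvg Tn T ->
  mxcvg (fun n => Sn n *m Tn n) (S *m T).
Proof.
move=> SS TT i j; rewrite mxE; under eq_fun do rewrite mxE.
by apply: ccvg_sum => k; apply: ccvgM.
Qed.

Lemma mxcvg_adj Tn T : mxcvg Tn T -> mxcvg (fun n => adjmx (Tn n)) (adjmx T).
Proof.
move=> TT i j; rewrite !mxE; under eq_fun do rewrite !mxE.
exact: ccvg_conj.
Qed.

Lemma mxcvg_cauchy Tn : seq_cauchy (@opnorm R d) Tn -> exists T, mxcvg Tn T.
Proof.
move=> cT.
have /choice[t tP] (ij : 'I_d * 'I_d) : exists a, ccvg (fun n => Tn n ij.1 ij.2) a.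
  apply: ccvg_cauchy => e /cT[n0 Tlt]; exists n0 => m n n0m n0n.
  apply: le_lt_trans (Tlt m n n0m n0n).
  by apply: le_trans (normc_entry_le _ ij.1 ij.2); rewrite !mxE.
by exists (\matrix_(i, j) t (i, j)) => i j; rewrite mxE; apply: tP (i, j).
Qed.

Lemma mxcvg_null Tn : seq_lim (@opnorm R d) Tn 0 -> mxcvg Tn 0.
Proof.
move=> T0 i j; rewrite mxE.
apply: (@ccvg0_norm _ _ (fun n => opnorm (Tn n))) => [|n]; last exact: normc_entry_le.
apply/cvgrPdist_lt => e /T0[n0 Tlt]; exists n0 => // n /= /Tlt.
by rewrite subr0 sub0r normrN ger0_norm ?opnorm_ge0.
Qed.

End MatrixLimits.

Section UnitaryRepresentation.
Variables (R : realType) (d : nat) (G : groupType).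
Local Notation C := R[i].
Variable M : G -> 'M[C]_d.
Hypothesis MM : forall g h, M (g * h)%g = M g *m M h.
Hypothesis MV : forall g, M g^-1%g = adjmx (M g).

Let rho : grpalg R G -> 'M[C]_d := glift M.

Let rhoZD c x y : rho (c *: x + y) = c *: rho x + rho y.
Proof. exact: linearP. Qed.

Let rho0 : rho 0 = 0.
Proof. exact: linear0. Qed.

Let rho_gelt g : rho (gelt R g) = M g.
Proof. exact: glift_gelt. Qed.

Let rhoM x y : rho (x * y) = rho x *m rho y.
Proof.
move: rhoZD rho0 rho_gelt; move: rho => r rZD r0 rg.
elim/grpalg_ind: x => [|c g x IH]; first by rewrite mul0r !r0 mul0mx.
rewrite [in LHS]mulrDl -scalerAl !rZD IH mulmxDl -scalemxAl; congr (_ *: _ + _).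
elim/grpalg_ind: y {IH x} => [|e h y IH]; first by rewrite mulr0 !r0 mulmx0.
by rewrite [in LHS]mulrDr -scalerAr !rZD IH -geltM !rg MM mulmxDr -scalemxAr.
Qed.

Let adjmxZD (c : C) (S T : 'M[C]_d) : adjmx (c *: S + T) = c^* *: adjmx S + adjmx T.
Proof. by apply/matrixP => i j; rewrite !mxE rmorphD rmorphM. Qed.

Let rho_star x : rho (star x) = adjmx (rho x).
Proof.
move: rhoZD rho0 rho_gelt; move: rho => r rZD r0 rg.
elim/grpalg_ind: x => [|c g x IH].
  have -> : star 0 = 0 :> grpalg R G.
    by apply: (addrI (star 0)); rewrite -starD !addr0.
  by rewrite r0; apply/matrixP => i j; rewrite !mxE conjc0.
by rewrite starD starZ star_gelt !rZD IH !rg MV adjmxZD.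
Qed.

Let rho_csn : is_cstar_seminorm (fun x => opnorm (rho x)).
Proof.
split=> [x y|c x|x y|x].
- by rewrite -(scale1r x) rhoZD scale1r scale1r opnormD.
- by rewrite -[c *: x]addr0 rhoZD rho0 addr0 opnormZ.
- by rewrite rhoM opnormM.
- by rewrite rhoM rho_star opnorm_adjM.
Qed.

Let rho_le x : opnorm (rho x) <= @cnorm R (grpalg R G) x.
Proof. exact: (csnorm_le_full x rho_csn). Qed.

Let rhoB x y : rho (x - y) = rho x - rho y.
Proof. exact: linearB. Qed.

Local Notation cauchyseq := (cauchyseq (grpalg R G)).

Let rho_cvg (u : cauchyseq) : exists T, mxcvg (fun n => rho (u n)) T.
Proof.
apply: mxcvg_cauchy => e e0; have [n0 un0] := asboolP _ (cseqP u) _ e0.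
exists n0 => m n n0m n0n; rewrite -rhoB.
exact: le_lt_trans (rho_le _) (un0 _ _ n0m n0n).
Qed.

(** The hypotheses on [M] make it a unitary representation of [G] up to a
    possible degenerate subspace.  The largest C*-seminorm dominates
    f |-> ||rho f||, so [rho] maps Cauchy sequences to convergent ones and null
    sequences to null ones, and its values on representatives define [pi] on the
    completion; the algebraic identities pass to the limit. *)
Lemma ex_fullCstar_extension : exists pi : fullCstar R G -> 'M[C]_d,
  representation pi /\ forall g, pi (gunit R g) = M g.
Proof.
have [pi piP] := choice (fun X : completion (grpalg R G) => rho_cvg (crepr X)).
(* [pi] is given by the chosen representatives; any other representative
   differs from them by a null sequence. *)
have picvg (u : cauchyseq) : mxcvg (fun n => rho (u n)) (pi (cclass u)).
  have -> : (fun n => rho (u n)) = (fun n => rho (crepr (cclass u) n) +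
      rho ((u - crepr (cclass u)) n)).
    by apply/funext => n; rewrite [X in _ + X]rhoB addrC subrK.
  rewrite -[X in mxcvg _ X]addr0; apply: mxcvgD; first exact: piP.
  apply: mxcvg_null => e e0; have [n0 un0] := is_nullP _ (cclass_crepr u) _ e0.
  exists n0 => n n0n; rewrite subr0.
  exact: le_lt_trans (rho_le _) (un0 _ n0n).
exists pi; split; last first.
  move=> g; apply: mxcvg_unique (picvg (cconst (gelt R g))) _ => /=.
  by rewrite rho_gelt; apply: mxcvg_cst.
split.
- move=> c; elim/cclass_ind => u; elim/cclass_ind => v.
  rewrite -[c *: cclass u]cclassZ -cclassD.
  apply: mxcvg_unique (picvg _) _.
  have -> : (fun n => rho ((c *: u + v) n)) = (fun n => c *: rho (u n) + rho (v n)).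
    by apply/funext => n; apply: rhoZD.
  exact: mxcvgD (mxcvgZ _ (picvg _)) (picvg _).
- elim/cclass_ind => u; elim/cclass_ind => v; rewrite -[cclass u * _]cclassM.
  apply: mxcvg_unique (picvg _) _.
  have -> : (fun n => rho ((u * v) n)) = (fun n => rho (u n) *m rho (v n)).
    by apply/funext => n; apply: rhoM.
  exact: mxcvgM.
- elim/cclass_ind => u; rewrite -[star _]cclass_star.
  apply: mxcvg_unique (picvg _) _.
  have -> : (fun n => rho (cstarseq u n)) = (fun n => adjmx (rho (u n))).
    by apply/funext => n; apply: rho_star.
  exact: mxcvg_adj.
Qed.

End UnitaryRepresentation.

(** * Words in unitary matrices *)

Section Words.
Variables (R : realType) (n d : nat).
Local Notation C := R[i].

Definition unitaries (U : 'I_n -> 'M[C]_d) : Prop :=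
  forall i, adjmx (U i) *m U i = 1%:M.

Definition lettermx (U : 'I_n -> 'M[C]_d) (x : letter n) : 'M[C]_d :=
  if x.2 then U x.1 else adjmx (U x.1).

Definition wordmx U (s : seq (letter n)) : 'M[C]_d :=
  foldr (fun x T => lettermx U x *m T) 1%:M s.

Lemma adjmxM (S T : 'M[C]_d) : adjmx (S *m T) = adjmx T *m adjmx S.
Proof. by rewrite /adjmx trmx_mul map_mxM. Qed.

Lemma adjmx1 : adjmx 1%:M = 1%:M :> 'M[C]_d.
Proof. by rewrite /adjmx trmx1 map_mx1. Qed.

Lemma wordmx_cat U s t : wordmx U (s ++ t) = wordmx U s *m wordmx U t.
Proof. by elim: s => [|x s IHs] /=; rewrite ?mul1mx // IHs mulmxA. Qed.

(** The last letter of a word acts first, so a word that labels a path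
    v_0, v_1, .. carries its end point back to [v 0], collecting the weights. *)
Lemma wordmx_telescope U x0 s (v : nat -> 'cV[C]_d) (c : nat -> C) :
  (forall j, (j < size s)%N -> lettermx U (nth x0 s j) *m v j.+1 = c j *: v j) ->
  wordmx U s *m v (size s) = (\prod_(j < size s) c j) *: v 0.
Proof.
elim: s v c => [|x s IHs] v c vE /=; first by rewrite big_ord0 scale1r mul1mx.
have := IHs (v \o succn) (c \o succn) (fun j => vE j.+1).
rewrite /= -mulmxA => ->; rewrite -scalemxAr (vE 0%N) // scalerA.
by rewrite big_ord_recl mulrC.
Qed.

Variable U : 'I_n -> 'M[C]_d.
Hypothesis U_unitary : unitaries U.

Lemma adj_lettermx x : adjmx (lettermx U x) = lettermx U (linv x).
Proof. by rewrite /lettermx /=; case: x.2; rewrite ?adjmxK. Qed.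

Lemma lettermx_linv x : lettermx U (linv x) *m lettermx U x = 1%:M.
Proof.
by rewrite /lettermx /=; case: x.2 => /=; [|apply: mulmx1C]; apply: U_unitary.
Qed.

Lemma lettermx_linvr x : lettermx U x *m lettermx U (linv x) = 1%:M.
Proof. exact/mulmx1C/lettermx_linv. Qed.

Lemma wordmx_push x s : wordmx U (push x s) = lettermx U x *m wordmx U s.
Proof.
case: s => [|y s] //=; case: eqP => [->|_] //=.
by rewrite mulmxA lettermx_linvr mul1mx.
Qed.

Lemma wordmx_fgmul (a b : freegroup n) :
  wordmx U (a * b)%g = wordmx U a *m wordmx U b.
Proof.
have -> : (a * b)%g = foldr (@push n) b a :> seq _ by [].
elim: (fgword a) => [|x s IHs] /=; first by rewrite mul1mx.
by rewrite wordmx_push IHs mulmxA.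
Qed.

Lemma wordmx_fginv (a : freegroup n) : wordmx U a^-1%g = adjmx (wordmx U a).
Proof.
have -> : (a^-1)%g = rev (map (@linv n) a) :> seq _ by [].
elim: (fgword a) => [|x s IHs] /=; first by rewrite adjmx1.
by rewrite rev_cons -cats1 wordmx_cat /= mulmx1 IHs adjmxM adj_lettermx.
Qed.

End Words.

(** * Monomial unitaries with a prescribed eigenvalue *)

(** A partial injection of a finite set, given by the pairs (f j, g j), extends
    to a permutation: add the pairs one by one, correcting the permutation
    obtained so far by a transposition that fixes all earlier targets. *)
Lemma ex_perm_extend (I : eqType) (T : finType) (r : seq I) (f g : I -> T) :
  {in r &, injective f} -> {in r &, injective g} ->
  exists s : {perm T}, {in r, forall j, s (f j) = g j}.
Proof.
elim: r => [|k r IHr] f_inj g_inj; first by exists 1%g.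
have sub j : j \in r -> j \in k :: r by rewrite inE orbC => ->.
have [s sE] := IHr (sub_in2 sub f_inj) (sub_in2 sub g_inj).
have [kr|k_notin] := boolP (k \in r).
  by exists s => j; rewrite inE => /orP[/eqP->|]; apply: sE.
exists (s * tperm (s (f k)) (g k))%g => j; rewrite inE permM.
case/orP => [/eqP->|jr]; first exact: tpermL.
have jk : j != k by apply: contraNneq k_notin => <-.
rewrite (sE j jr) tpermD //.
  rewrite -(sE j jr) eq_sym; apply: contra_neq jk => /perm_inj/f_inj -> //.
    exact: sub.
  exact: mem_head.
rewrite eq_sym; apply: contra_neq jk => /g_inj -> //.
  exact: sub.
exact: mem_head.
Qed.

Section Monomial.
Variables (R : realType) (d : nat).
Local Notation C := R[i].
Local Notation e k := (delta_mx k 0 : 'cV[C]_d).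

(** A permutation matrix extending the partial injection, with its columns
    multiplied by the required phases. *)
Lemma ex_monomial_unitary (I : finType) (P : pred I) (f g : I -> 'I_d)
    (c : I -> C) :
  (forall j, normc (c j) = 1) -> {in P &, injective f} -> {in P &, injective g} ->
  exists U : 'M[C]_d, adjmx U *m U = 1%:M /\
    forall j, P j -> U *m e (f j) = c j *: e (g j).
Proof.
move=> c1 f_inj g_inj.
have mem_P j : (j \in enum P) = P j by rewrite mem_enum.
have [||s sE] := @ex_perm_extend _ _ (enum P) f g.
- by move=> j k; rewrite !mem_P; apply: f_inj.
- by move=> j k; rewrite !mem_P; apply: g_inj.
pose w b := if [pick j | P j & f j == b] is Some j then c j else 1.
have w1 b : normc (w b) = 1 by rewrite /w; case: pickP => *; rewrite ?c1 ?normc1.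
exists (\matrix_(a, b) ((a == s b)%:R * w b)); split=> [|j Pj].
  apply/matrixP => a b; rewrite !mxE (bigD1 (s a)) //= big1 => [|k ka].
    rewrite !mxE eqxx mul1r addr0 (inj_eq perm_inj).
    have [<-|_] := eqVneq a b; last by rewrite mul0r mulr0.
    by rewrite mul1r mul_conjc_normc w1 expr1n.
  by rewrite !mxE (negPf ka) mul0r conjc0 mul0r.
rewrite -colE; apply/matrixP => a o; rewrite !mxE ord1 eqxx andbT.
rewrite sE ?mem_P // mulrC; congr (_ * _).
rewrite /w; case: pickP => [k /andP[Pk /eqP fkj]|/(_ j)]; last by rewrite Pj eqxx.
by congr c; apply: f_inj.
Qed.

Variable n : nat.

(** The cycle has vertices 0, .., l, embedded in the index set of the basis;
    edge j carries the letter [x j] from vertex j+1 to vertex j, modulo l+1.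
    The phase lam sits on edge 0, so it is collected once around the cycle. *)
Lemma cyclically_reduced_eigen (l : nat) (x : 'I_l.+1 -> letter n) (lam : C) :
  normc lam = 1 -> (l < d)%N -> (forall j, x (ordS j) != linv (x j)) ->
  exists2 U : 'I_n -> 'M[C]_d, unitaries U &
    exists2 v : 'cV[C]_d, vnorm v = 1 &
      wordmx U [seq x j | j <- enum 'I_l.+1] *m v = lam *: v.
Proof.
move=> lam1 ld xS; pose emb := widen_ord ld.
have emb_inj : injective emb by move=> j k /(congr1 val) /= /val_inj.
pose c (j : 'I_l.+1) : C := if j == ord0 then lam else 1.
have c1 j : normc (c j) = 1 by rewrite /c; case: ifP; rewrite ?normc1.
(* The generator of [x j] maps [src j] to [tgt j]: it follows the edge if the
   letter is positive and traverses it backwards otherwise. *)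
pose src j := if (x j).2 then ordS j else j.
pose tgt j := if (x j).2 then j else ordS j.
(* Two edges with the same generator and opposite signs cannot be consecutive,
   by cyclic reducedness; this makes sources and targets injective. *)
have no_fold i j k : (x j).1 = i -> (x k).1 = i -> (x j).2 = ~~ (x k).2 ->
    ordS j <> k.
  move=> xj xk jk jS; have /eqP[] := xS j; rewrite jS.
  by rewrite [LHS]surjective_pairing /linv xj xk jk negbK.
have src_inj i : {in [pred j | (x j).1 == i] &, injective (emb \o src)}.
  move=> j k /eqP xj /eqP xk /emb_inj; rewrite /src.
  case Ej: (x j).2; case Ek: (x k).2 => //; first exact: ordS_inj.
    by move/no_fold: (xj) => /(_ _ xk); rewrite Ej Ek => /(_ erefl).
  by move/esym; move/no_fold: (xk) => /(_ _ xj); rewrite Ej Ek => /(_ erefl).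
have tgt_inj i : {in [pred j | (x j).1 == i] &, injective (emb \o tgt)}.
  move=> j k /eqP xj /eqP xk /emb_inj; rewrite /tgt.
  case Ej: (x j).2; case Ek: (x k).2 => //; last exact: ordS_inj.
    by move/esym; move/no_fold: (xk) => /(_ _ xj); rewrite Ej Ek => /(_ erefl).
  by move/no_fold: (xj) => /(_ _ xk); rewrite Ej Ek => /(_ erefl).
(* For a negative letter the adjoint of the generator acts along the edge, so
   the generator gets the conjugate phase. *)
pose w j := if (x j).2 then c j else (c j)^*.
have w1 j : normc (w j) = 1 by rewrite /w; case: ifP; rewrite ?Defs.normcJ c1.
have [U UP] := choice (fun i => ex_monomial_unitary w1 (src_inj i) (tgt_inj i)).
have edge j : lettermx U (x j) *m e (emb (ordS j)) = c j *: e (emb j).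
  have [UU Ue] := UP (x j).1; have := Ue j (eqxx _).
  rewrite /lettermx /src /tgt /w /=; case: (x j).2 => // Uej.
  rewrite -[in RHS](mul1mx (e (emb j))) -UU -mulmxA Uej -scalemxAr scalerA.
  by rewrite mulrC mul_conjc_normc c1 expr1n scale1r.
exists U; first by move=> i; case: (UP i).
exists (e (emb ord0)); first exact: vnorm_delta.
pose v k := e (emb (inZp k : 'I_l.+1)).
have := @wordmx_telescope _ _ _ U (x ord0) [seq x j | j <- enum 'I_l.+1] v
  (fun k => c (inZp k)).
have v0 : v 0%N = e (emb ord0).
  by congr (e (emb _)); apply: val_inj.
have vl : v l.+1 = e (emb ord0).
  by congr (e (emb _)); apply: val_inj => /=; rewrite modnn.
rewrite size_map size_enum_ord vl v0 => -> //; last first.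
  move=> k kl; have -> : nth (x ord0) [seq x j | j <- enum 'I_l.+1] k = x (inZp k).
    rewrite (nth_map ord0) ?size_enum_ord //; congr x; apply: val_inj => /=.
    by rewrite nth_enum_ord ?modn_small.
  rewrite -edge; congr (_ *m e (emb _)); apply: val_inj => /=.
  by rewrite -addn1 -modnDml addn1.
congr (_ *: _); rewrite big_ord_recl big1 => [|k _].
  rewrite mulr1 /c.
  by have -> : inZp (@ord0 l) = ord0 :> 'I_l.+1 by apply: val_inj.
rewrite /c; case: eqP => // /(congr1 val) /=.
by rewrite modn_small // ltnS ltn_ord.
Qed.

(** Induction on the length: unless [s] is cyclically reduced, it has the form
    y^-1 t y with [t] reduced and nonempty, and an eigenvector of [t] is moved
    by the unitary of y^-1 to one of [s] for the same eigenvalue. *)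
Lemma reduced_eigen (s : seq (letter n)) (lam : C) :
  normc lam = 1 -> reduced s -> s != [::] -> (size s <= d)%N ->
  exists2 U : 'I_n -> 'M[C]_d, unitaries U &
    exists2 v : 'cV[C]_d, vnorm v = 1 & wordmx U s *m v = lam *: v.
Proof.
move=> lam1; have [m] := ubnP (size s); elim: m s => // m IHm [//|x s] ltsm.
move=> reds _ sd.
have [cyc|] := boolP (path.cycle (fun y z => z != linv y) (x :: s)).
  pose y (j : 'I_(size s).+1) := nth x (x :: s) j.
  have <- : [seq y j | j <- enum 'I_(size s).+1] = x :: s.
    rewrite /y (map_comp (nth x (x :: s)) val) val_enum_ord.
    exact: (mkseq_nth x (x :: s)).
  apply: cyclically_reduced_eigen => // j.
  have := (pathP x cyc) j; rewrite size_rcons => /(_ (ltn_ord j)).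
  rewrite -rcons_cons nth_rcons /= ltnS leq_ord /y /=.
  rewrite nth_rcons; case: ltnP => [js|].
    by rewrite modn_small.
  move=> sj; have -> : j = size s :> nat by apply/eqP; rewrite eqn_leq sj -ltnS ltn_ord.
  by rewrite eqxx modnn.
rewrite /= rcons_path; have -> /= : path (fun y z => z != linv y) x s by [].
rewrite negbK => /eqP xE.
case/lastP: s => [|s y] in ltsm reds sd xE *.
  by have := congr1 snd xE; rewrite /=; case: x.2.
rewrite last_rcons in xE; rewrite {x}xE in ltsm reds sd *.
move: reds; rewrite /reduced /= rcons_path => /andP[reds_y sy].
have reds : reduced s := path_sorted reds_y.
have s_neq0 : s != [::].
  by apply: contraNneq sy => ->; rewrite /= linvK eqxx.
rewrite /= size_rcons in ltsm sd.
have [|U UU [v v1 vE]] := IHm s _ reds s_neq0 (ltnW (ltnW sd)).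
  by apply: leq_trans _ (ltnSE ltsm); apply: leqW.
exists U => //; exists (lettermx U (linv y) *m v).
  by rewrite vnorm_isometry // adj_lettermx lettermx_linv.
rewrite -cats1 wordmx_cat /= mulmx1 -!mulmxA.
by rewrite [lettermx U y *m _]mulmxA lettermx_linvr // mul1mx vE -scalemxAr.
Qed.

End Monomial.

(** * The theorem *)

(** For nonzero [a] and [b] take the quotient of the phases, (b/|b|) / (a/|a|). *)
Lemma ex_aligning_phase (R : realType) (a b : R[i]) :
  exists2 lam : R[i], normc lam = 1 & normc (a * lam + b) = normc a + normc b.
Proof.
have [->|a0] := eqVneq a 0.
  by exists 1; rewrite ?normc1 // mul0r add0r normc0 add0r.
have [->|b0] := eqVneq b 0.
  by exists 1; rewrite ?normc1 // mulr1 normc0 !addr0.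
have na : normc a != 0 by apply: contra_neq a0 => /eq0_normc.
have nb : normc b != 0 by apply: contra_neq b0 => /eq0_normc.
have norm_norm (z : R[i]) : normc (normc z)%:C = normc z.
  by rewrite normc_real ger0_norm ?normc_ge0.
exists ((normc a)%:C / a * (b / (normc b)%:C)).
  by rewrite !normcM !normcV !norm_norm !divff // mulr1.
have -> : a * ((normc a)%:C / a * (b / (normc b)%:C)) + b =
    b / (normc b)%:C * (normc a + normc b)%:C.
  have nbC : (normc b)%:C != 0 by rewrite eq_complex /= negb_and nb.
  rewrite rmorphD /=; move: nbC; move: (normc a)%:C (normc b)%:C => x y y0.
  by field; apply/andP.
rewrite !normcM normcV norm_norm divff // mul1r normc_real.
by rewrite ger0_norm // addr_ge0 ?normc_ge0.
Qed.

Unset Implicit Arguments.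

Theorem proposition6p1 (R : realType) (alpha beta : R[i]) (n : nat)
    (w1 w2 : freegroup n) (hw : w1 <> w2) :
  let l := wlen (w2^-1 * w1)%g in
  exists pi : fullCstar R (freegroup n) -> 'M[R[i]]_(2 * l),
    representation pi /\
    opnorm (pi (alpha *: gunit R w1 + beta *: gunit R w2)) =
      normc alpha + normc beta.
Proof.
move=> l; set u := (w2^-1 * w1)%g.
have [lam lam1 lamE] := ex_aligning_phase alpha beta.
have u_neq0 : fgword u != [::].
  apply: contra_not_neq hw => u0; apply/esym/(mulgI w2^-1%g).
  by rewrite mulVg; apply: val_inj; apply: esym u0.
have ul : (size u <= 2 * l)%N by rewrite mul2n -addnn leq_addr.
have [U UU [v v1 uv]] := reduced_eigen lam1 (fgwordP u) u_neq0 ul.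
pose M (w : freegroup n) := wordmx U w.
have MM g h : M (g * h)%g = M g *m M h by exact: wordmx_fgmul.
have MV g : M g^-1%g = adjmx (M g) by exact: wordmx_fginv.
have M_isometry g : adjmx (M g) *m M g = 1%:M by rewrite -MV -MM mulVg.
have [pi [pi_rep piE]] := ex_fullCstar_extension MM MV.
exists pi; split=> //; have [pi_lin _ _] := pi_rep.
have piZD a x y : pi (a *: x + y) = a *: pi x + pi y by exact: pi_lin.
have pi0 : pi 0 = 0.
  by apply: (addrI (pi 0)); have := piZD 1 0 0; rewrite !scale1r !addr0.
have -> : pi (alpha *: gunit R w1 + beta *: gunit R w2) =
    alpha *: M w1 + beta *: M w2.
  by rewrite piZD piE -[beta *: gunit R w2]addr0 piZD piE pi0 addr0.
apply/eqP; rewrite eq_le; apply/andP; split.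
  apply: le_trans (opnormD _ _) _; rewrite !opnormZ.
  by rewrite lerD // ler_piMr ?normc_ge0 ?opnorm_isometry.
rewrite -lamE; set T := alpha *: M w1 + beta *: M w2.
apply: (@le_trans _ _ (vnorm (T *m v))); last by rewrite vnorm_le_opnorm ?v1.
have -> : T *m v = (alpha * lam + beta) *: (M w2 *m v).
  have Mw1 : M w1 = M w2 *m M u by rewrite -MM mulKVg.
  by rewrite /T Mw1 mulmxDl -!scalemxAl -mulmxA uv -scalemxAr scalerA scalerDl.
by rewrite vnormZ vnorm_isometry // v1 mulr1.
Qed.
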